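(* Let $V:\mathbb{R}^n\to\mathbb{R}$ be locally Lipschitz and let $h\in\mathbb{R}$. Suppose that (V1) $V(-q)=V(q)$ for all $q\in\mathbb{R}^n$; (V2) there exist $\mu_1>0$ and $\mu_2\ge 0$ such that $\langle y,q\rangle\ge\mu_1V(q)-\mu_2$ for all $q\in\mathbb{R}^n$ and all $y\in\partial V(q)$; (V3) $V(q)\ge h$ for all $q$ with $|q|$ sufficiently large. If $h>\frac{\mu_2}{\mu_1}$, then the system $$-\ddot q(t)\in\partial V(q(t)),\qquad \tfrac12|\dot q(t)|^2+V(q(t))=h$$ has at least one non-constant periodic solution (with the given energy $h$).
   Context: $\partial V$ is the Clarke generalized gradient: $V^0(q,v):=\limsup_{w\to q,\ t\downarrow 0}\frac{V(w+tv)-V(w)}{t}$ and $\partial V(q):=\{y\in\mathbb{R}^n:\langle y,v\rangle\le V^0(q,v)\ \forall v\in\mathbb{R}^n\}$. A solution is a continuously differentiable $q:\mathbb{R}\to\mathbb{R}^n$ with $\dot q$ locally absolutely continuous, satisfying the differential inclusion for almost every $t$ and the energy equation for every $t$. *)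

(* Defs.v *)
From HB Require Import structures.
From mathcomp Require Import all_boot all_order all_algebra.
From mathcomp Require Import all_classical all_reals all_analysis.
Import Order.TTheory GRing.Theory Num.Theory.
Import numFieldNormedType.Exports.

Set Implicit Arguments.
Unset Strict Implicit.
Unset Printing Implicit Defensive.

Local Open Scope classical_set_scope.
Local Open Scope ring_scope.

Definition dot (R : realType) (n : nat) (u v : 'rV[R]_n) : R :=
  \sum_(i < n) u ord0 i * v ord0 i.

(* The library norm `|u| on 'rV[R]_n is the sup norm. *)
Definition enorm (R : realType) (n : nat) (u : 'rV[R]_n) : R :=
  Num.sqrt (dot u u).

(* Since lipschitz_on is stated with the sup norm, its constants differ from
   the Euclidean ones by a factor depending only on n. *)
Definition locally_lipschitz (R : realType) (n : nat)
    (V : 'rV[R]_n -> R) : Prop :=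
  forall q : 'rV[R]_n, exists2 U : set 'rV[R]_n,
    nbhs q U & [lipschitz V x | x in U].

(* limsup of (V (w + t v) - V w) / t as w --> q (w = q allowed) and t --> 0
   with t > 0, a priori an extended real. *)
Definition clarke_derivative (R : realType) (n : nat)
    (V : 'rV[R]_n -> R) (q v : 'rV[R]_n) : \bar R :=
  limf_esup (fun wt : 'rV[R]_n * R =>
      ((V (wt.1 + wt.2 *: v) - V wt.1) / wt.2)%:E)
    (filter_prod (nbhs q) (0 : R)^'+).

Definition clarke_gradient (R : realType) (n : nat)
    (V : 'rV[R]_n -> R) (q : 'rV[R]_n) : set 'rV[R]_n :=
  [set y | forall v : 'rV[R]_n,
    ((dot y v)%:E <= clarke_derivative V q v)%E].

Definition absolutely_continuous_on (R : realType) (n : nat) (a b : R)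
    (f : R -> 'rV[R]_n) : Prop :=
  forall e : R, 0 < e -> exists2 d : R, 0 < d &
    forall (k : nat) (s t : 'I_k -> R),
      (forall i, [/\ a <= s i, s i <= t i & t i <= b]) ->
      trivIset [set: 'I_k] (fun i => `]s i, t i[%classic) ->
      \sum_(i < k) (t i - s i) < d ->
      \sum_(i < k) enorm (f (t i) - f (s i)) < e.

Definition locally_absolutely_continuous (R : realType) (n : nat)
    (f : R -> 'rV[R]_n) : Prop :=
  forall a b : R, a <= b -> absolutely_continuous_on a b f.

(* The derivability conjuncts are needed because derive1 is a total operator,
   with an unspecified value where the limit does not exist. *)
Definition is_solution (R : realType) (n : nat)
    (V : 'rV[R]_n -> R) (h : R) (q : R -> 'rV[R]_n) : Prop :=
  [/\ (forall t : R, derivable q t 1) /\ continuous (derive1 q),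
      locally_absolutely_continuous (derive1 q),
      {ae (@lebesgue_measure R), forall t : R, derivable (derive1 q) t 1 /\
         clarke_gradient V (q t) (- derive1 (derive1 q) t)} &
      forall t : R, 2^-1 * enorm (derive1 q t) ^+ 2 + V (q t) = h].

(* Main.v *)
(* The solution is a brake orbit, found by minimising the action
   int 1/2 |q'|^2 + max (h - V q) 0 over free times among curves from 0 to
   {V >= h}.  Evenness of V gives 0 in the generalized gradient at 0, hence
   V 0 < h.  The minimiser leaves 0 and reaches {V = h} at rest, so the odd
   reflection at 0 and the even reflection at the end time extend it to a
   periodic solution.

   The minimisation is done on discrete chains with time step tau, with a
   small extra cost tau ^+ 3 per step that bounds their length.  Minimality in
   one node gives the inclusion; replacing k consecutive steps by k - 1 or
   k + 1 steps on a straight line gives the energy equation up to a factor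
   1 + O(1/k), as tau -> 0; testing the inclusion with q itself and summing by
   parts (virial identity) bounds the duration, by (V2).  Energy must be
   obtained in this way, because for a general locally Lipschitz V it does not
   follow from the inclusion. *)

Require Import Defs.
From HB Require Import structures.
From mathcomp Require Import all_boot all_order all_algebra.
From mathcomp Require Import all_classical all_reals all_analysis.
From mathcomp Require Import ring lra zify.
Import Order.TTheory GRing.Theory Num.Theory.
Import numFieldNormedType.Exports.

Set Implicit Arguments.
Unset Strict Implicit.
Unset Printing Implicit Defensive.

Local Open Scope classical_set_scope.
Local Open Scope ring_scope.

(** * Euclidean and sup norms *)

(** Since V has no derivative, nothing can be obtained by differentiating along a minimiser; all
    information comes from comparing two finite chains, with bounds uniform in [tau]. Free duration
    becomes a free number of steps, which is the only source of the energy equation. The cutoff in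
    the potential makes every step cost positive, so the end of a minimal chain is its only node in
    {V >= h}, and at all other nodes the cutoff is inactive. The inclusion bounds second differences
    by the Lipschitz constant of V times [tau ^+ 2], so the limit velocity is Lipschitz. Positions
    and velocities then converge pointwise with their estimates, and the inclusion passes to the
    limit in the form of [clarke_gradientP]: one bound on difference quotients near a point serves
    all nearby nodes, so it can be summed over many steps before [tau] tends to 0. At a turning
    point the discrete inclusion is lost. Arrival at rest still bounds the second difference there,
    and a short block meets at most one such index, whose contribution is O([tau]). *)

Lemma dotC (R : realType) n (u v : 'rV[R]_n) : dot u v = dot v u.
Proof. by apply: eq_bigr => i _; rewrite mulrC. Qed.

Lemma dotDl (R : realType) n (u v w : 'rV[R]_n) :
  dot (u + v) w = dot u w + dot v w.
Proof. by rewrite -big_split; apply: eq_bigr => i _; rewrite mxE mulrDl. Qed.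

Lemma dotZl (R : realType) n a (u w : 'rV[R]_n) : dot (a *: u) w = a * dot u w.
Proof. by rewrite mulr_sumr; apply: eq_bigr => i _; rewrite mxE mulrA. Qed.

Lemma dotDr (R : realType) n (u v w : 'rV[R]_n) :
  dot w (u + v) = dot w u + dot w v.
Proof. by rewrite !(dotC w) dotDl. Qed.

Lemma dotZr (R : realType) n a (u w : 'rV[R]_n) : dot w (a *: u) = a * dot w u.
Proof. by rewrite !(dotC w) dotZl. Qed.

Lemma dotNl (R : realType) n (u w : 'rV[R]_n) : dot (- u) w = - dot u w.
Proof. by rewrite -scaleN1r dotZl mulN1r. Qed.

Lemma dotNr (R : realType) n (u w : 'rV[R]_n) : dot w (- u) = - dot w u.
Proof. by rewrite !(dotC w) dotNl. Qed.

Lemma dot0l (R : realType) n (w : 'rV[R]_n) : dot 0 w = 0.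
Proof. by rewrite -(scale0r w) dotZl mul0r. Qed.

Lemma dot_ge0 (R : realType) n (u : 'rV[R]_n) : 0 <= dot u u.
Proof. by apply: sumr_ge0 => i _; rewrite -expr2 sqr_ge0. Qed.

Lemma enorm2E (R : realType) n (u : 'rV[R]_n) : enorm u ^+ 2 = dot u u.
Proof. by rewrite sqr_sqrtr // dot_ge0. Qed.

Lemma coord_le_norm (R : realType) n (u : 'rV[R]_n) i : `|u ord0 i| <= `|u|.
Proof.
have /mapP[j Hj ->] : `|u ord0 i| \in [seq `|u x.1 x.2| | x : 'I_1 * 'I_n].
  by apply/mapP; exists (ord0, i) => //=; rewrite mem_enum.
by rewrite [leRHS]/Num.norm /= mx_normrE; apply/bigmax_geP; right => /=; exists j.
Qed.

Lemma norm_le_coord (R : realType) n (u : 'rV[R]_n) b :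
  0 <= b -> (forall i, `|u ord0 i| <= b) -> `|u| <= b.
Proof.
move=> b0 H; rewrite [leLHS]/Num.norm /= mx_normrE; apply/bigmax_leP; split=> //.
by move=> [i j] _ /=; rewrite (ord1 i).
Qed.

Lemma normsq_le_dot (R : realType) n (u : 'rV[R]_n) : `|u| ^+ 2 <= dot u u.
Proof.
rewrite -enorm2E ler_pXn2r ?nnegrE ?sqrtr_ge0//.
apply: norm_le_coord; first exact: sqrtr_ge0.
move=> i; rewrite -ler_sqr ?nnegrE ?sqrtr_ge0// enorm2E.
rewrite real_normK ?num_real// /dot (bigD1 i)//= -expr2 lerDl.
by apply: sumr_ge0 => j _; rewrite -expr2 sqr_ge0.
Qed.

Lemma norm_le_enorm (R : realType) n (u : 'rV[R]_n) : `|u| <= enorm u.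
Proof.
by rewrite -ler_sqr ?nnegrE ?sqrtr_ge0// enorm2E normsq_le_dot.
Qed.

Lemma dot_le_norm (R : realType) n (u v : 'rV[R]_n) :
  `|dot u v| <= n%:R * `|u| * `|v|.
Proof.
apply: le_trans (ler_norm_sum _ _ _) _.
apply: (@le_trans _ _ (\sum_(i < n) `|u| * `|v|)).
  by apply: ler_sum => i _; rewrite normrM ler_pM ?coord_le_norm.
by rewrite sumr_const card_ord -[leLHS]mulr_natl mulrA.
Qed.

Lemma enorm_le_norm (R : realType) n (u : 'rV[R]_n) : enorm u <= n%:R * `|u|.
Proof.
rewrite -ler_sqr ?nnegrE ?sqrtr_ge0 ?mulr_ge0// enorm2E.
apply: le_trans (le_trans (ler_norm _) (dot_le_norm _ _)) _.
rewrite exprMn !expr2 -mulrA ler_wpM2r ?mulr_ge0//.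
case: n u => [|n] u; first by rewrite mulr0.
by rewrite ler_peMr// ler1n.
Qed.

Lemma coord_continuous_rV (R : realType) n (i : 'I_n) :
  continuous (fun u : 'rV[R]_n => u ord0 i).
Proof. exact: coord_continuous. Qed.

Lemma cvg_dot (R : realType) n (T : Type) (F : set_system T) {FF : Filter F}
    (f g : T -> 'rV[R]_n) (a b : 'rV[R]_n) :
  f @ F --> a -> g @ F --> b -> (fun x => dot (f x) (g x)) @ F --> dot a b.
Proof.
move=> fa gb; rewrite /dot.
apply: cvg_big => [|i _]; first exact: add_continuous.
apply: cvgM.
  exact: (cvg_comp f (fun u : 'rV_n => u ord0 i) fa (@coord_continuous_rV R n i a)).
exact: (cvg_comp g (fun u : 'rV_n => u ord0 i) gb (@coord_continuous_rV R n i b)).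
Qed.

(** * Discrete action and minimal chains *)

Definition action (R : realType) n (c : 'rV[R]_n -> 'rV[R]_n -> R)
    (u : nat -> 'rV[R]_n) (N : nat) : R :=
  \sum_(i < N) c (u i) (u i.+1).

(** The constraints act on each coordinate separately, so [S] is a product of compact sets and
    Tychonoff applies. Whole sequences are kept, entries beyond [N] being merely bounded, so that
    one space serves all lengths. *)
Lemma exists_min_chain_of_length (R : realType) n
    (c : 'rV[R]_n -> 'rV[R]_n -> R) (T : set 'rV[R]_n) (B : R) (N : nat) :
  continuous (fun p : 'rV[R]_n * 'rV[R]_n => c p.1 p.2) -> closed T ->
  let S := [set u : nat -> 'rV[R]_n |
             [/\ u 0%N = 0, forall i, `|u i| <= B & T (u N)]] in
  S !=set0 ->
  exists2 u, S u & forall w, S w -> action c u N <= action c w N.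
Proof.
move=> cc cT S S0.
pose A (i : nat) := [set x : 'rV[R]_n |
   [/\ `|x| <= B, (i == 0%N) ==> (x == 0) & i = N -> T x]].
have AS : S = [set u : nat -> 'rV[R]_n | forall i, A i (u i)].
  apply/seteqP; split=> [u [u0 uB uT] i|u uA].
    split=> //; first by apply/implyP => /eqP ->; rewrite u0.
    by move=> ->.
  split; first by have [_ /eqP] := uA 0%N.
    by move=> i; have [] := uA i.
  by have [_ _] := uA N; apply.
have cA : forall i, compact (A i).
  move=> i; apply: bounded_closed_compact.
    by exists B; split; [exact: num_real|move=> x Bx u [uB _ _]; exact: le_trans uB (ltW Bx)].
  have -> : A i = closed_ball_ Num.norm 0 B `&`
      ([set x | (i == 0%N) ==> (x == 0)] `&` [set x | i = N -> T x]).
    by apply/seteqP; split=> x; rewrite /A /closed_ball_/= sub0r normrN => -[] // ? [].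
  apply: closedI; first exact: closed_closed_ball_.
  apply: closedI.
    case: (i == 0%N) => /=.
      have -> : [set x : 'rV[R]_n | x == 0] = [set 0].
        by apply/seteqP; split=> x /=; [move/eqP|move=> ->].
      apply: accessible_closed_set1; exact/hausdorff_accessible/norm_hausdorff.
    rewrite (_ : mkset _ = setT); first exact: closedT.
    by apply/seteqP; split.
  have [->|iN] := eqVneq i N.
    by rewrite (_ : mkset _ = T) //; apply/seteqP; split=> x //=; apply.
  rewrite (_ : mkset _ = setT); first exact: closedT.
  by apply/seteqP; split=> x //= _ e; rewrite e eqxx in iN.
(* In the product topology the action is continuous because it reads only the coordinates up to
   [N]. *)
pose X : topologicalType := prod_topology (fun _ : nat => 'rV[R]_n).
have cS : compact (S : set X).
  rewrite AS; exact: tychonoff.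
have cact : continuous (fun u : X => action c u N).
  rewrite /action; apply: continuous_big => [|i _]; first exact: add_continuous.
  move=> u.
  have pc (k : nat) : (fun v : X => v k) x @[x --> u] --> u k.
    exact: (@proj_continuous nat (fun _ : nat => 'rV[R]_n) k u).
  exact: (cvg_comp2 (h := c) (pc i) (pc i.+1) (cc (u (i : nat), u i.+1))).
have [u Su umin] := @compact_EVT_min X R _ S S0 cS (continuous_subspaceT cact).
exists u; first by rewrite inE in Su.
by move=> w Sw; apply: umin; rewrite inE.
Qed.

(** Against a competitor of cost [a], only chains of cost at most [a] matter. These have at most
    [a / e] steps, each of length at most [s], so they stay in a fixed ball and only finitely many
    lengths remain; the best of the minimisers of each length is minimal. *)
Lemma exists_min_chain (R : realType) n
    (c : 'rV[R]_n -> 'rV[R]_n -> R) (T : set 'rV[R]_n) (e : R) :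
  continuous (fun p : 'rV[R]_n * 'rV[R]_n => c p.1 p.2) -> closed T ->
  0 < e -> (forall x y, e <= c x y) ->
  (forall a, exists s, forall x y, c x y <= a -> `|y - x| <= s) ->
  (exists N (u : nat -> 'rV[R]_n), u 0%N = 0 /\ T (u N)) ->
  exists N (u : nat -> 'rV[R]_n), [/\ u 0%N = 0, T (u N) &
    forall N' (w : nat -> 'rV[R]_n), w 0%N = 0 -> T (w N') ->
      action c u N <= action c w N'].
Proof.
move=> cc cT e0 ce cs [N0 [u0 [u00 u0T]]].
have c_ge0 x y : 0 <= c x y by rewrite (le_trans (ltW e0)).
pose a := action c u0 N0.
have [s sP] := cs a.
have a0 : 0 <= a by apply: sumr_ge0 => i _.
pose Nm := (Num.bound (a / e)).
pose B := Nm%:R * `|s|.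
pose S N := [set u : nat -> 'rV[R]_n |
             [/\ u 0%N = 0, forall i, `|u i| <= B & T (u N)]].
have trunc N w : w 0%N = 0 -> T (w N) -> action c w N <= a ->
    (N <= Nm)%N /\ exists2 w', S N w' & action c w' N = action c w N.
  move=> w0 wT wa.
  have NNm : (N <= Nm)%N.
    have : N%:R * e <= a.
      apply: le_trans wa; rewrite /action.
      apply: (@le_trans _ _ (\sum_(i < N) e)).
        by rewrite sumr_const card_ord -[leRHS]mulr_natl.
      by apply: ler_sum.
    rewrite -ler_pdivlMr// => Na.
    have : a / e < Nm%:R.
      by apply: archi_boundP; rewrite divr_ge0// ltW.
    by move=> /(le_lt_trans Na); rewrite ltr_nat => /ltnW.
  split=> //.
  have step (i : 'I_N) : `|w i.+1 - w i| <= `|s|.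
    apply: le_trans (ler_norm s); apply: sP; apply: le_trans wa.
    rewrite /action (bigD1 i)//= lerDl; exact: sumr_ge0.
  have wi i : (i <= N)%N -> `|w i| <= i%:R * `|s|.
    elim: i => [|i IH] iN; first by rewrite w0 normr0 mul0r.
    rewrite -(subrK (w i) (w i.+1)) -natr1 mulrDl mul1r addrC.
    apply: le_trans (ler_normD _ _) _; apply: lerD; first exact/IH/ltnW.
    exact: (step (Ordinal iN)).
  (* Stopping the sequence at [N] makes all its entries bounded, as membership in [S N] demands,
     without changing the action. *)
  exists (fun i => w (minn i N)).
    split; rewrite ?min0n ?minnn//.
    move=> i; apply: le_trans (wi _ (geq_minr _ _)) _.
    by apply: ler_wpM2r => //; rewrite ler_nat; apply: leq_trans (geq_minr _ _) NNm.
  by apply: eq_bigr => i _; rewrite !(minn_idPl _)// ltnW.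
have mN N : S N !=set0 ->
    exists2 u, S N u & forall w, S N w -> action c u N <= action c w N.
  exact: exists_min_chain_of_length.
pose best N := [set u | S N u /\ forall w, S N w -> action c u N <= action c w N].
pose m N := xget (fun=> 0) (best N).
have mP N : S N !=set0 -> S N (m N) /\ forall w, S N w -> action c (m N) N <= action c w N.
  move=> /mN[u Su umin].
  by apply: (xgetPex _ (P := best N)); exists u.
pose P (N : 'I_Nm.+1) := `[< S N !=set0 >].
have [N0Nm [w0 Sw0 aw0]] := trunc N0 u0 u00 u0T (lexx _).
have PN0 : P (inord N0) by apply/asboolP; exists w0; rewrite inordK.
pose Ns := [arg min_(N < inord N0 | P N) action c (m N) N]%O.
have [SNs NsP] : S Ns !=set0 /\ forall N : 'I_Nm.+1, P N -> action c (m Ns) Ns <= action c (m N) N.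
  rewrite /Ns; case: Order.TotalTheory.arg_minP => // N /asboolP PN H.
  by split.
have [[m0 mB mT] mmin] := mP _ SNs.
exists Ns, (m Ns); split=> // N' w w0' wT.
have le_a N'' w'' : w'' 0%N = 0 -> T (w'' N'') -> action c w'' N'' <= a ->
    action c (m Ns) Ns <= action c w'' N''.
  move=> h1 h2 h3; have [h4 [w' Sw' <-]] := trunc _ _ h1 h2 h3.
  have SN'' : S N'' !=set0 by exists w'.
  apply: le_trans ((mP _ SN'').2 _ Sw').
  have := NsP (inord N''); rewrite inordK//; apply.
  by apply/asboolP; rewrite inordK.
have [wa|/ltW aw] := leP (action c w N') a; first exact: le_a.
apply: le_trans aw; exact: le_a.
Qed.

Definition min_chain (R : realType) n (c : 'rV[R]_n -> 'rV[R]_n -> R)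
    (T : set 'rV[R]_n) (N : nat) (u : nat -> 'rV[R]_n) : Prop :=
  [/\ u 0%N = 0, T (u N) &
    forall N' (w : nat -> 'rV[R]_n), w 0%N = 0 -> T (w N') ->
      action c u N <= action c w N'].

Lemma action_cat (R : realType) n (c : 'rV[R]_n -> 'rV[R]_n -> R) u a b :
  action c u (a + b) = action c u a + action c (fun i => u (a + i)%N) b.
Proof.
by rewrite /action big_split_ord /=; congr (_ + _); apply: eq_bigr => i _; rewrite addnS.
Qed.

Lemma eq_action (R : realType) n (c : 'rV[R]_n -> 'rV[R]_n -> R) u w N :
  (forall i, (i <= N)%N -> u i = w i) -> action c u N = action c w N.
Proof. by move=> uw; apply: eq_bigr => i _; rewrite !uw// ltnW. Qed.

(** Splicing [w] into [u] in place of the block gives a competitor of another length. Hence [k] and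
    [m] may differ, the discrete form of a change of duration. *)
Lemma min_chain_block (R : realType) n (c : 'rV[R]_n -> 'rV[R]_n -> R) T N u :
  min_chain c T N u -> forall j k m w, (j + k <= N)%N ->
  w 0%N = u j -> w m = u (j + k)%N ->
  action c (fun i => u (j + i)%N) k <= action c w m.
Proof.
move=> [u0 uT umin] j k m w jkN w0 wm.
pose x i := if (i <= j)%N then u i else if (i <= j + m)%N then w (i - j)%N
            else u (i - (j + m) + (j + k))%N.
have x1 i : (i <= j)%N -> x i = u i by rewrite /x => ->.
have x2 i : (i <= m)%N -> x (j + i)%N = w i.
  move=> im; rewrite /x -{2}(addn0 j) leq_add2l leqn0.
  have [->|i0] := eqVneq i 0%N; first by rewrite addn0 w0.
  by rewrite leq_add2l im addKn.
have x3 i : x (j + m + i)%N = u (j + k + i)%N.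
  have [->|i0] := eqVneq i 0%N; first by rewrite !addn0 x2.
  rewrite /x ifF; last by lia.
  by rewrite ifF; [congr u|]; lia.
pose p := (N - (j + k))%N.
have NE : N = (j + k + p)%N by rewrite /p subnKC.
have := umin (j + m + p)%N x.
rewrite x1// x3 -NE => /(_ u0 uT).
rewrite {1}NE !action_cat.
rewrite (@eq_action _ _ _ x u j) //.
rewrite (@eq_action _ _ _ (fun i => x (j + i)%N) w m) //.
rewrite (@eq_action _ _ _ (fun i => x (j + m + i)%N) (fun i => u (j + k + i)%N)) //.
by rewrite lerD2r lerD2l.
Qed.

(** Cutting the chain at an earlier visit to [T] would save a positive cost. *)
Lemma min_chain_first_hit (R : realType) n (c : 'rV[R]_n -> 'rV[R]_n -> R) T N u :
  (forall x y, 0 < c x y) -> min_chain c T N u ->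
  forall i, (i < N)%N -> ~ T (u i).
Proof.
move=> c0 [u0 uT umin] i iN uiT; have := umin i u u0 uiT.
rewrite -(subnKC (ltnW iN)) action_cat gerDl leNgt => /negP; apply.
rewrite /action; case: (N - i)%N (subn_gt0 i N) => [|k] kP; first by rewrite iN in kP.
rewrite big_ord_recl; apply: ltr_pwDl => //; apply: sumr_ge0 => ? _; exact: ltW.
Qed.

(** The limsup is an infimum over neighbourhoods of suprema of quotients, so testing against it
    amounts to testing against every real [D] that bounds all quotients on some neighbourhood. This
    form has no extended reals and survives a small move of the point [q]. *)
Lemma clarke_gradientP (R : realType) n (V : 'rV[R]_n -> R) q y :
  clarke_gradient V q y <->
  forall v (e D : R), 0 < e ->
    (forall w t, `|w - q| < e -> 0 < t < e -> V (w + t *: v) - V w <= D * t) ->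
    dot y v <= D.
Proof.
split=> [yV v e D e0 H|H v].
  rewrite -lee_fin; apply: le_trans (yV v) _.
  rewrite /clarke_derivative /limf_esup.
  apply: ge_ereal_inf; exists (ereal_sup
    [set ((V (wt.1 + wt.2 *: v) - V wt.1) / wt.2)%:E | wt in
       ball q e `*` [set t | 0 < t < e]]).
    exists (ball q e `*` [set t | 0 < t < e]) => //.
    exists (ball q e, [set t | 0 < t < e]) => //=; split; first exact: nbhsx_ballx.
    near=> t; apply/andP; split; near: t; first exact: nbhs_right_gt.
    exact: nbhs_right_lt.
  apply: ge_ereal_sup => _ [[w t] /= [wq /andP[t0 te]] <-].
  rewrite lee_fin ler_pdivrMr//; apply: H; rewrite ?t0//.
  by move: wq; rewrite -ball_normE /= distrC.
apply: le_ereal_inf_tmp => _ [A [[B C] /= [Bq C0] BCA] <-].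
have [e /= e0 eB] := (iffLR (nbhs_ballP q B)) Bq.
have [d /= d0 dC] : exists2 d : R, 0 < d & forall t, 0 < t < d -> C t.
  have /nbhs_ballP[d /= d0 dC] := C0.
  exists d => // t /andP[t0 td]; apply: dC => //.
  by rewrite -ball_normE /= sub0r normrN gtr0_norm.
set s := ereal_sup _.
have sP w t : `|w - q| < e -> 0 < t < d ->
    (((V (w + t *: v) - V w) / t)%:E <= s)%E.
  move=> wq td; apply: ereal_sup_ubound; exists (w, t) => //.
  apply: BCA; split=> /=; last exact: dC.
  by apply: eB; rewrite -ball_normE /= distrC.
case: s sP => [D| |] sP; [|by rewrite leey|].
  rewrite lee_fin; apply: (H v (Num.min e d)) => [|w t].
    by rewrite lt_min e0.
  rewrite !lt_min => /andP[we _] /andP[t0 /andP[_ td]].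
  rewrite -ler_pdivrMr// -lee_fin; apply: sP => //.
  by rewrite t0.
(* The supremum is not -oo, since the quotient at base point [q] is a real number below it. *)
have := sP q (d / 2); rewrite subrr normr0 => /(_ e0).
have d2 : 0 < d / 2 by rewrite divr_gt0.
by rewrite d2 ltr_pdivrMr// mulr_natr mulr2n ltrDl d0 => /(_ isT).
Unshelve. all: by end_near. Qed.

(** Testing with plus and minus the basis vectors, of sup norm 1, bounds each coordinate of [y]. The
    radius [d / 2] keeps both ends of a difference within [d] of [q]. *)
Lemma clarke_gradient_norm (R : realType) n (V : 'rV[R]_n -> R) q y (d L : R) :
  0 < d -> 0 <= L ->
  (forall x z, `|x - q| < d -> `|z - q| < d -> `|V x - V z| <= L * `|x - z|) ->
  clarke_gradient V q y -> `|y| <= L.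
Proof.
move=> d0 L0 VL /clarke_gradientP yV.
have yv v : `|v| <= 1 -> dot y v <= L.
  move=> v1; apply: (yV v (d / 2)); first by rewrite divr_gt0.
  move=> w t wq /andP[t0 td].
  have tv : `|t *: v| <= t by rewrite normrZ gtr0_norm// ler_piMr// ltW.
  apply: le_trans (ler_norm _) _; apply: le_trans (VL _ _ _ _) _.
  - rewrite addrAC; apply: le_lt_trans (ler_normD _ _) _.
    by rewrite (splitr d) ltrD// (le_lt_trans tv).
  - by rewrite (lt_trans wq)// ltr_pdivrMr// mulr_natr mulr2n ltrDl.
  - by rewrite addrC addKr ler_wpM2l.
apply: norm_le_coord => // i.
have e1 : `|delta_mx ord0 i : 'rV[R]_n| <= 1.
  apply: norm_le_coord => // j; rewrite mxE eqxx /=.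
  by case: (j == i); rewrite ?normr1 ?normr0.
have de : dot y (delta_mx ord0 i) = y ord0 i.
  rewrite /dot (bigD1 i)//= mxE !eqxx mulr1 big1 ?addr0// => j ji.
  by rewrite mxE (negbTE ji) andbF mulr0.
by rewrite ler_norml -[_ ord0 i]de lerNl -dotNr !yv// normrN.
Qed.

(** The first term is the kinetic action of uniform motion from [x] to [y] in time [tau]. The
    potential is sampled at the left end only, so moving an inner node changes a single potential
    term. *)
Definition jcost (R : realType) n (tau e : R) (W : 'rV[R]_n -> R)
    (x y : 'rV[R]_n) : R :=
  dot (y - x) (y - x) / (2 * tau) + tau * (W x + e).

Lemma telescope_chain (R : realType) n (u : nat -> 'rV[R]_n) N :
  \sum_(i < N) (u i.+1 - u i) = u N - u 0%N.
Proof. by rewrite -(big_mkord xpredT (fun i => u i.+1 - u i)) telescope_sumr. Qed.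

Lemma dot_suml (R : realType) n k (v : 'I_k -> 'rV[R]_n) w :
  dot (\sum_i v i) w = \sum_i dot (v i) w.
Proof.
by apply: (big_morph (fun v => dot v w)); [move=> ? ?; exact: dotDl|exact: dot0l].
Qed.

(** Cauchy-Schwarz, from expanding the sum of the squares of [K *: v i - s]. It says that among
    chains with given ends and number of steps the uniform straight one has least kinetic cost. *)
Lemma dot_sum_le (R : realType) n k (v : 'I_k -> 'rV[R]_n) :
  dot (\sum_i v i) (\sum_i v i) <= k%:R * \sum_i dot (v i) (v i).
Proof.
case: k v => [|k] v; first by rewrite !big_ord0 dot0l mulr0.
set s := \sum_i v i; set K : R := k.+1%:R; set S := \sum_i _.
have K0 : 0 < K by rewrite ltr0n.
have : 0 <= \sum_i dot (K *: v i - s) (K *: v i - s).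
  by apply: sumr_ge0 => i _; exact: dot_ge0.
have -> : \sum_i dot (K *: v i - s) (K *: v i - s) = K ^+ 2 * S - K * dot s s.
  transitivity (\sum_i (K ^+ 2 * dot (v i) (v i) - 2 * K * dot (v i) s + dot s s)).
    apply: eq_bigr => i _.
    rewrite !(dotDl, dotDr, dotNl, dotNr, dotZl, dotZr) (dotC s).
    by ring.
  rewrite big_split big_split /= -mulr_sumr sumrN -mulr_sumr -dot_suml sumr_const card_ord.
  by rewrite -/s -[dot s s *+ _]mulr_natl -/K /S; ring.
by rewrite expr2 -mulrA -mulrBr pmulr_rge0// subr_ge0.
Qed.

(** * Comparison inequalities for minimal chains of the discrete action *)

Section min_jcost.
Variables (R : realType) (n : nat) (tau e : R) (W : 'rV[R]_n -> R).
Variables (T : set 'rV[R]_n) (N : nat) (u : nat -> 'rV[R]_n).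
Hypothesis (tau0 : 0 < tau) (umin : min_chain (jcost tau e W) T N u).

(* Bisecting one step halves its kinetic cost and adds one potential term. *)
Lemma min_chain_speed i : (i < N)%N ->
  dot (u i.+1 - u i) (u i.+1 - u i) <=
    4 * tau ^+ 2 * (W (u i + 2^-1 *: (u i.+1 - u i)) + e).
Proof.
move=> iN; set D := u i.+1 - u i; set x := _ + _ *: D.
pose w k := if k is k'.+1 then if k' is 0%N then x else u i.+1 else u i.
have := min_chain_block umin (j := i) (k := 1) (m := 2) (w := w).
rewrite addn1 => /(_ iN erefl erefl).
rewrite /action big_ord_recl big_ord0 !big_ord_recl big_ord0 /= /bump /= !addr0 /jcost.
rewrite addn0 addn1 -/D.
have -> : x - u i = 2^-1 *: D by rewrite /x addrC addKr.
have -> : u i.+1 - x = 2^-1 *: D.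
  rewrite /x opprD addrA -/D -{1}[D]scale1r -scalerBl; congr (_ *: _).
  by rewrite {1}(splitr 1) mul1r addrK.
rewrite !(dotZl, dotZr) => H.
have {}H : dot D D / (2 * tau) <= dot D D / (4 * tau) + tau * (W x + e).
  have E : 2^-1 * (2^-1 * dot D D) / (2 * tau) = dot D D / (4 * tau) / 2.
    by field; rewrite ?gt_eqF.
  by rewrite E in H; lra.
have E : dot D D / (2 * tau) = 2 * (dot D D / (4 * tau)).
  by field; rewrite ?gt_eqF.
rewrite E mulr_natl mulr2n lerD2l ler_pdivrMr ?mulr_gt0// in H.
by apply: le_trans H _; rewrite le_eqVlt; apply/orP; left; apply/eqP; ring.
Qed.

(** The middle node of two steps is moved by [- p]. The kinetic cost being quadratic, its change is
    exactly the right-hand side divided by [tau], while the potential changes only in the second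
    step. *)
Lemma min_chain_two_step i p : (i.+1 < N)%N ->
  tau ^+ 2 * (W (u i.+1) - W (u i.+1 - p)) <=
    dot (u i.+2 - 2 *: u i.+1 + u i) p + dot p p.
Proof.
move=> iN.
pose w k := if k is k'.+1 then if k' is 0%N then u i.+1 - p else u i.+2 else u i.
have := min_chain_block umin (j := i) (k := 2) (m := 2) (w := w).
rewrite addn2 => /(_ iN erefl erefl).
rewrite /action !big_ord_recl !big_ord0 /= /bump /= !addr0 /jcost.
rewrite !addn0 !addn1 addn2.
set a := u i; set b := u i.+1; set c := u i.+2.
have -> : b - p - a = (b - a) - p by rewrite addrAC.
have -> : c - (b - p) = (c - b) + p by apply/rowP => k; rewrite !mxE; ring.
have -> : c - 2 *: b + a = (c - b) - (b - a).
  by apply/rowP => k; rewrite !mxE; ring.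
move: (b - a) (c - b) => x y.
rewrite !(dotDl, dotDr, dotNl, dotNr) !(dotC p) => H.
have -> : dot y p - dot x p + dot p p = tau *
    (((dot y y + dot y p + (dot y p + dot p p)) +
      (dot x x - dot x p - (dot x p - dot p p)) - dot x x - dot y y) / (2 * tau)).
  by field; rewrite gt_eqF.
rewrite expr2 -mulrA ler_pM2l//.
by move: H; rewrite !mulrDl !mulNr; lra.
Qed.

(** A block of [k] steps is compared with [m] equal steps on the segment between its ends. [d] is
    the squared mean speed of the block and [omega] an error for the variation of [W]; by
    [dot_sum_le] the kinetic cost of the block is at least that of uniform motion. The values
    [m = k + 1] and [m = k - 1] will give the two halves of the energy equation. *)
Lemma min_chain_block_energy j k m omega :
  (0 < k)%N -> (0 < m)%N -> (j + k <= N)%N ->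
  let D := u (j + k)%N - u j in
  let d := dot D D / (k%:R * tau) ^+ 2 in
  (forall i, (i <= k)%N -> W (u j) - omega <= W (u (j + i)%N)) ->
  (forall t, 0 <= t <= 1 -> W (u j + t *: D) <= W (u j) + omega) ->
  k%:R * (d / 2 + (W (u j) - omega + e)) <=
    d * k%:R ^+ 2 / (2 * m%:R) + m%:R * (W (u j) + omega + e).
Proof.
move=> k0 m0 jkN D d Wlo Whi.
have k0' : 0 < k%:R :> R by rewrite ltr0n.
have m0' : 0 < m%:R :> R by rewrite ltr0n.
have := min_chain_block umin (j := j) (k := k) (m := m)
  (w := fun i => u j + (i%:R / m%:R) *: D) jkN.
rewrite mul0r scale0r addr0 divff ?gt_eqF// scale1r.
have -> : u j + D = u (j + k)%N by rewrite /D addrC subrK.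
move=> /(_ erefl erefl) H.
rewrite -(ler_pM2l tau0).
have -> : tau * (k%:R * (d / 2 + (W (u j) - omega + e))) =
    dot D D / k%:R / (2 * tau) + \sum_(i < k) tau * (W (u j) - omega + e).
  rewrite sumr_const card_ord -[X in _ = _ + X]mulr_natl /d; field.
  by rewrite !gt_eqF.
have -> : tau * (d * k%:R ^+ 2 / (2 * m%:R) + m%:R * (W (u j) + omega + e)) =
    \sum_(i < m) (dot D D / m%:R ^+ 2 / (2 * tau) + tau * (W (u j) + omega + e)).
  rewrite sumr_const card_ord -[RHS]mulr_natl /d; field.
  by rewrite !gt_eqF.
apply: le_trans (le_trans _ H) _; rewrite /action /jcost.
  rewrite big_split /= lerD//; last first.
    apply: ler_sum => i _; rewrite ler_pM2l// lerD2r.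
    exact/Wlo/ltnW.
  rewrite -mulr_suml ler_pM2r ?invr_gt0 ?mulr_gt0// ler_pdivrMr// mulrC.
  have -> : D = \sum_(i < k) (u (j + i.+1)%N - u (j + i)%N).
    by rewrite (telescope_chain (fun i => u (j + i)%N)) addn0.
  exact: dot_sum_le.
apply: ler_sum => i _; apply: lerD.
  rewrite le_eqVlt; apply/orP; left; apply/eqP; congr (_ / _).
  have -> : u j + (i.+1%:R / m%:R) *: D - (u j + (i%:R / m%:R) *: D) = m%:R^-1 *: D.
    rewrite opprD addrACA subrr add0r -scalerBl -mulrBl; congr (_ *: _).
    by rewrite -natr1 addrAC subrr add0r mul1r.
  by rewrite dotZl dotZr; field; rewrite gt_eqF.
rewrite ler_pM2l// lerD2r; apply: Whi.
by rewrite divr_ge0//= ler_pdivrMr// mul1r ler_nat ltnW.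
Qed.

End min_jcost.

(** * Regularity and symmetry of the potential *)

Lemma locally_lipschitz_continuous (R : realType) n (V : 'rV[R]_n -> R) :
  locally_lipschitz V -> continuous V.
Proof.
move=> VL q; have [U Uq VU] := VL q.
have [k [k0 kU]] : exists k, 0 < k /\ k.-lipschitz_U V.
  have [k0 [_ H]] := VU.
  exists (Num.max 0 k0 + 1); split; first by rewrite ltr_wpDl// le_max lexx.
  by apply: H; rewrite ltr_pwDr// le_max lexx orbT.
apply: (@cvg_trans _ _ (V @ nbhs q)) => //; apply/cvgrPdist_lt => e e0.
have Uqq : U q := nbhs_singleton Uq.
have ke : 0 < k^-1 * e by rewrite mulr_gt0// invr_gt0.
apply: filterS2 Uq (nbhsx_ballx q _ ke) => x Ux qx.
apply: le_lt_trans (kU (q, x) _) _.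
  by split.
by rewrite -ltr_pdivlMl//=; move: qx; rewrite -ball_normE.
Qed.

(** Compactness of the ball makes the constants uniform. A single parameter [l] tending to +oo
    serves as Lipschitz constant and, through [l^-1], as radius, so the near-covering form of
    compactness applies directly. *)
Lemma locally_lipschitz_ball (R : realType) n (V : 'rV[R]_n -> R) (B : R) :
  locally_lipschitz V -> exists L d : R, [/\ 0 <= L, 0 < d &
    forall q x z, `|q| <= B -> `|x - q| < d -> `|z - q| < d ->
      `|V x - V z| <= L * `|x - z|].
Proof.
move=> VL.
have cB : compact (closed_ball_ Num.norm (0 : 'rV[R]_n) B).
  apply: bounded_closed_compact; last exact: closed_closed_ball_.
  exists B; split; [exact: num_real|move=> x Bx u; rewrite /closed_ball_ /= sub0r normrN => uB].
  exact: le_trans uB (ltW Bx).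
have /compact_near_coveringP/(_ _ (+oo%R : set_system R)) := cB.
move=> /(_ (fun l q => forall x z, `|x - q| < l^-1 -> `|z - q| < l^-1 ->
  `|V x - V z| <= l * `|x - z|) _) [].
  move=> q0 _; have [U Uq [k0 [_ VU]]] := VL q0.
  have [e /= e0 eU] := (iffLR (nbhs_ballP q0 U)) Uq.
  near=> q l => x z xq zq.
  have l0 : 0 < l by near: l; apply: nbhs_pinfty_gt; exact: num_real.
  have le2 : l^-1 < e / 2.
    rewrite invf_plt ?posrE//; last by rewrite divr_gt0.
    by near: l; apply: nbhs_pinfty_gt; exact: num_real.
  have xU x' : `|x' - q| < l^-1 -> U x'.
    move=> x'q; apply: eU; rewrite -ball_normE /=.
    rewrite -(subrK q q0) -addrA; apply: le_lt_trans (ler_normD _ _) _.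
    rewrite (splitr e) ltrD//; last by rewrite distrC (lt_trans x'q).
    by near: q; apply: cvgr_dist_lt => //; rewrite divr_gt0.
  have kl : k0 < l by near: l; apply: nbhs_pinfty_gt; exact: num_real.
  by apply: (VU _ kl (x, z)); split; exact: xU.
move=> l0 [_ H].
exists (Num.max 0 l0 + 1), (Num.max 0 l0 + 1)^-1.
have l1 : 0 < Num.max 0 l0 + 1 by rewrite ltr_wpDl// le_max lexx.
split; [exact: ltW|by rewrite invr_gt0|move=> q x z qB].
apply: (H (Num.max 0 l0 + 1)); first by rewrite ltr_pwDr// le_max lexx orbT.
by rewrite /closed_ball_ /= sub0r normrN.
Unshelve. all: by end_near. Qed.

Lemma clarke_gradient_even (R : realType) n (V : 'rV[R]_n -> R) q y :
  (forall q, V (- q) = V q) ->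
  clarke_gradient V q y -> clarke_gradient V (- q) (- y).
Proof.
move=> V1 /clarke_gradientP yV; apply/clarke_gradientP => v e D e0 H.
rewrite dotNl -dotNr; apply: (yV _ e) => // w t wq t0.
have := H (- w) t; rewrite -opprD normrN => /(_ wq t0).
by rewrite V1 -(V1 (- w + _)) opprD opprK -scalerN.
Qed.

(* By evenness, the difference quotients from - t / 2 *: v to t / 2 *: v vanish. *)
Lemma clarke_gradient0_even (R : realType) n (V : 'rV[R]_n -> R) :
  (forall q, V (- q) = V q) -> clarke_gradient V 0 0.
Proof.
move=> V1; apply/clarke_gradientP => v e D e0 H; rewrite dot0l.
pose t := Num.min (e / 2) (e / 2 / (`|v| + 1)).
have v1 : 0 < `|v| + 1 by rewrite ltr_wpDl.
have t0 : 0 < t by rewrite lt_min !divr_gt0.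
have te : t < e.
  by rewrite gt_min; apply/orP; left; rewrite ltr_pdivrMr// mulr_natr mulr2n ltrDl.
have := H (- (2^-1 * t) *: v) t.
rewrite t0 te subr0 -scalerDl.
have -> : - (2^-1 * t) + t = 2^-1 * t by lra.
rewrite scaleNr V1 subrr normrN normrZ gtr0_norm ?mulr_gt0// => /(_ _ isT).
rewrite pmulr_lge0//; apply.
have : t * (`|v| + 1) <= e / 2.
  by rewrite -ler_pdivlMr// ge_min lexx orbT.
have := normr_ge0 v; have : 0 <= t * `|v| by rewrite mulr_ge0// ltW.
rewrite mulrDr mulr1 -mulrA; lra.
Qed.

(** Where V <= h this is the kinetic energy prescribed by the energy equation. The cutoff at 0 keeps
    step costs positive for chains that wander into V > h. *)
Definition depth (R : realType) n (V : 'rV[R]_n -> R) (h : R) (x : 'rV[R]_n) : R :=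
  Num.max (h - V x) 0.

Lemma depth_ge0 (R : realType) n (V : 'rV[R]_n -> R) h x : 0 <= depth V h x.
Proof. by rewrite /depth le_max lexx orbT. Qed.

Lemma depth_inside (R : realType) n (V : 'rV[R]_n -> R) h x :
  V x <= h -> depth V h x = h - V x.
Proof. by move=> Vh; rewrite /depth max_l// subr_ge0. Qed.

Lemma depth_outside (R : realType) n (V : 'rV[R]_n -> R) h x :
  h <= V x -> depth V h x = 0.
Proof. by move=> Vh; rewrite /depth max_r// subr_le0. Qed.

Lemma depth_dist (R : realType) n (V : 'rV[R]_n -> R) h x z :
  `|depth V h x - depth V h z| <= `|V x - V z|.
Proof.
rewrite /depth; set a := V x; set b := V z.
case: (leP (h - a) 0) => ha; case: (leP (h - b) 0) => hb.
all: rewrite ler_norml; apply/andP; split.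
all: by case: (ger0P (a - b)) => ab; lra.
Qed.

Lemma depth_continuous (R : realType) n (V : 'rV[R]_n -> R) h :
  continuous V -> continuous (depth V h).
Proof.
move=> cV q; apply: (@cvg_trans _ _ (depth V h @ nbhs q)) => //; apply/cvgrPdist_lt => e e0; 
have /cvgrPdist_lt/(_ e e0) : V @ nbhs q --> V q := cV q.
by apply: filterS => x; exact: le_lt_trans (depth_dist _ _ _ _).
Qed.

Lemma depth_bounded (R : realType) n (V : 'rV[R]_n -> R) h r :
  continuous V -> (forall q, r <= enorm q -> h <= V q) ->
  exists Wm, forall x, depth V h x <= Wm.
Proof.
move=> cV V3; have cW : continuous (depth V h) := depth_continuous (h := h) cV.
have cB : compact (closed_ball_ Num.norm (0 : 'rV[R]_n) `|r|).
  apply: bounded_closed_compact; last exact: closed_closed_ball_.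
  exists `|r|; split; [exact: num_real|move=> x Bx u; rewrite /closed_ball_ /= sub0r normrN => uB].
  exact: le_trans uB (ltW Bx).
have B0 : closed_ball_ Num.norm (0 : 'rV[R]_n) `|r| !=set0.
  by exists 0; rewrite /closed_ball_ /= subr0 normr0.
have [c _ cmax] := compact_EVT_max B0 cB (continuous_subspaceT cW).
exists (depth V h c) => x.
have [xr|xr] := leP `|x| `|r|.
  by apply: cmax; rewrite inE /closed_ball_ /= sub0r normrN.
rewrite depth_outside ?depth_ge0//; apply: V3.
by apply: le_trans (norm_le_enorm _); apply: le_trans (ler_norm _) (ltW xr).
Qed.

Lemma jcost_continuous (R : realType) n tau e (W : 'rV[R]_n -> R) :
  continuous W ->
  continuous (fun p : 'rV[R]_n * 'rV[R]_n => jcost tau e W p.1 p.2).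
Proof.
move=> cW [x y]; rewrite /jcost /=.
have D : (fun p : 'rV[R]_n * 'rV[R]_n => p.2 - p.1) p @[p --> (x, y)] --> y - x.
  by apply: cvgB; [exact: cvg_snd|exact: cvg_fst].
apply: cvgD.
  by apply: cvgM; [exact: cvg_dot|exact: cvg_cst].
apply: cvgM; first exact: cvg_cst.
apply: cvgD; last exact: cvg_cst.
exact: (@cvg_comp _ _ _ fst W (nbhs (x, y)) (nbhs x) _ cvg_fst (cW x)).
Qed.

(** * Discrete orbits of prescribed energy *)

Lemma continuous_lt_ball (R : realType) n (V : 'rV[R]_n -> R) h q :
  continuous V -> V q < h ->
  exists2 e : R, 0 < e & forall x, `|x - q| < e -> V x < h.
Proof.
move=> cV Vq.
have /cvgrPdist_lt/(_ (h - V q)) : V @ nbhs q --> V q := cV q.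
rewrite subr_gt0 => /(_ Vq) /nbhs_ballP[e /= e0 eP].
exists e => // x xq; have /= := eP x.
rewrite -ball_normE /= distrC => /(_ xq).
by rewrite distrC => /(le_lt_trans (ler_norm _)); rewrite ltrD2r.
Qed.

(** Write q for [u i.+1] and y for the vector claimed to be a gradient. Where V < h,
    [min_chain_two_step] reads V q - V (q - p) >= y.p - |p|^2 / tau^2. The Clarke limsup allows
    moving base points, so q - s v may be taken as base with p = s v; after division by s the
    quadratic error vanishes with s. *)
Lemma min_chain_clarke (R : realType) n (V : 'rV[R]_n -> R) h tau e N u i :
  continuous V -> 0 < tau -> 0 < e ->
  min_chain (jcost tau e (depth V h)) [set x | h <= V x] N u ->
  (i.+1 < N)%N ->
  clarke_gradient V (u i.+1) (- (tau ^- 2 *: (u i.+2 - 2 *: u i.+1 + u i))).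
Proof.
move=> cV tau0 e0 umin iN; set S := u i.+2 - _ + _; set q := u i.+1.
have c0 x y : 0 < jcost tau e (depth V h) x y.
  rewrite /jcost ltr_wpDl// ?divr_ge0 ?dot_ge0 ?mulr_ge0 ?ltW//.
  by rewrite mulr_gt0// ltr_wpDl// depth_ge0.
have Vq : V q < h by rewrite ltNge; apply/negP/(min_chain_first_hit c0 umin iN).
have [r r0 rP] := continuous_lt_ball cV Vq.
apply/clarke_gradientP => v eps D eps0 H.
have tau20 : 0 < tau ^+ 2 by rewrite exprn_gt0.
apply/ler_addgt0Pr => eta eta0.
have vv1 : 0 < dot v v + 1 by rewrite ltr_wpDl// dot_ge0.
have etav : 0 < eta * tau ^+ 2 / (dot v v + 1).
  by apply: divr_gt0 => //; apply: mulr_gt0.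
(* [s] must keep [q - s *: v] in {V < h}, so that the depth is [h - V] at both points, stay within
   the radius where [H] applies, and make the quadratic error at most [eta]. *)
near (0 : R)^'+ => s.
have s0 : 0 < s by near: s; exact: nbhs_right_gt.
have v1 : 0 < `|v| + 1 by rewrite ltr_wpDl.
have sv : `|s *: v| <= s * (`|v| + 1).
  by rewrite normrZ gtr0_norm// ler_pM2l// lerDl.
have sr : `|s *: v| < r.
  apply: le_lt_trans sv _; rewrite -ltr_pdivlMr//.
  by near: s; apply: nbhs_right_lt; rewrite divr_gt0.
have seps : `|s *: v| < eps.
  apply: le_lt_trans sv _; rewrite -ltr_pdivlMr//.
  by near: s; apply: nbhs_right_lt; rewrite divr_gt0.
have se : s < eps by near: s; exact: nbhs_right_lt.
have sB : s < eta * tau ^+ 2 / (dot v v + 1) by near: s; exact: nbhs_right_lt.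
have svv : s * dot v v / tau ^+ 2 <= eta.
  rewrite ler_pdivrMr//.
  apply: (@le_trans _ _ (s * (dot v v + 1))); first by rewrite ler_pM2l// lerDl.
  by rewrite -ler_pdivlMr// ltW.
have Vs : V (q - s *: v) < h by apply: rP; rewrite addrAC subrr add0r normrN.
have Hs : V q - V (q - s *: v) <= D * s.
  have := H (q - s *: v) s; rewrite subrK; apply; last by rewrite s0.
  by rewrite addrAC subrr add0r normrN.
have := min_chain_two_step tau0 umin (s *: v) iN.
rewrite -/S -/q !depth_inside ?(ltW Vq) ?(ltW Vs)// !(dotZl, dotZr) => Hm.
rewrite dotNl dotZl.
have -> : - (tau ^- 2 * dot S v) = (- (s * dot S v)) / (s * tau ^+ 2).
  by field; rewrite !gt_eqF.
rewrite ler_pdivrMr ?mulr_gt0//.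
apply: (@le_trans _ _ (D * s * tau ^+ 2 + s * (s * dot v v))).
  have : tau ^+ 2 * (V q - V (q - s *: v)) <= tau ^+ 2 * (D * s) by rewrite ler_pM2l.
  by move: Hm; lra.
have : s * (s * dot v v) <= s * (eta * tau ^+ 2) by rewrite ler_pM2l// -ler_pdivrMr.
by lra.
Unshelve. all: by end_near. Qed.

(** Summation by parts; the boundary term at the start vanishes because [u 0%N = 0]. *)
Lemma chain_virial (R : realType) n (u : nat -> 'rV[R]_n) m : u 0%N = 0 ->
  \sum_(i < m) dot (2 *: u i.+1 - u i.+2 - u i) (u i.+1) =
  \sum_(i < m) dot (u i.+1 - u i) (u i.+1 - u i) - dot (u m.+1 - u m) (u m).
Proof.
move=> u0; elim: m => [|m IH].
  by rewrite !big_ord0 u0 dotC dot0l subrr.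
rewrite !big_ord_recr /= IH.
rewrite !(dotDl, dotDr, dotNl, dotNr, dotZl, dotZr) (dotC (u m) (u m.+1)).
by ring.
Qed.

Lemma chain_dist (R : realType) n (u : nat -> 'rV[R]_n) N (s : R) :
  (forall i, (i < N)%N -> `|u i.+1 - u i| <= s) ->
  forall j k, (j + k <= N)%N -> `|u (j + k)%N - u j| <= k%:R * s.
Proof.
move=> us j; elim=> [|k IH] jkN; first by rewrite addn0 subrr normr0 mul0r.
rewrite addnS in jkN *.
rewrite -(subrK (u (j + k)%N) (u (j + k).+1)) -addrA -natr1 mulrDl mul1r addrC.
by apply: le_trans (ler_normD _ _) _; rewrite lerD ?IH ?us// ltnW.
Qed.

Lemma le_of_sqr_le (R : realType) (a b : R) : 0 <= b -> a ^+ 2 <= b ^+ 2 -> a <= b.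
Proof.
move=> b0 ab; apply: le_trans (ler_norm a) _.
by rewrite -(ger0_norm b0) -ler_sqr ?nnegrE// !real_normK ?num_real.
Qed.

(** The constants are meant to be common to all small [tau]. The lower bound in [gc_time] keeps the
    period from collapsing, and [gc_last] says that the chain arrives at rest up to O([tau]). In
    [gc_energy], [r] is the squared mean speed over the block, and [E] tends to 0 with [tau] for
    fixed [k]. *)
Record good_chain (R : realType) n (V : 'rV[R]_n -> R) (h B M C c L d tau : R)
    (N : nat) (u : nat -> 'rV[R]_n) : Prop := GoodChain {
  gc_start : u 0%N = 0;
  gc_time : c <= N%:R * tau <= C;
  gc_bound : forall i, (i <= N)%N -> `|u i| <= B;
  gc_step : forall i, (i < N)%N -> `|u i.+1 - u i| <= M * tau;
  gc_second : forall i, (i.+1 < N)%N ->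
    `|u i.+2 - 2 *: u i.+1 + u i| <= C * tau ^+ 2;
  gc_last : forall i, i.+1 = N -> `|u i.+1 - u i| <= C * tau ^+ 2;
  gc_clarke : forall i, (i.+1 < N)%N ->
    clarke_gradient V (u i.+1) (- (tau ^- 2 *: (u i.+2 - 2 *: u i.+1 + u i)));
  gc_energy : forall j k, (1 < k)%N -> (j + k <= N)%N -> k%:R * (M * tau) < d ->
    let D := u (j + k)%N - u j in
    let r := dot D D / (k%:R * tau) ^+ 2 in
    let E := tau ^+ 2 + (2 * k%:R + 1) * (L * (k%:R * (M * tau))) in
    r / 2 * (k%:R / (k%:R + 1)) <= h - V (u j) + E /\
    h - V (u j) <= r / 2 * (k%:R / (k%:R - 1)) + E
}.

(** * Minimal chains with bounds uniform in the time step *)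

Section good_chains.
Variables (R : realType) (n : nat) (V : 'rV[R]_n -> R) (h mu1 mu2 : R).
Hypotheses (n_gt0 : (0 < n)%N) (V_lip : locally_lipschitz V)
  (V1 : forall q : 'rV[R]_n, V (- q) = V q) (mu1_gt0 : 0 < mu1)
  (V2 : forall q y : 'rV[R]_n,
      clarke_gradient V q y -> mu1 * V q - mu2 <= dot y q)
  (V3 : exists r : R, forall q : 'rV[R]_n, r <= enorm q -> h <= V q)
  (h_gt : mu2 / mu1 < h).

Lemma center_inside : V 0 < h.
Proof.
have := V2 (clarke_gradient0_even V1); rewrite dot0l subr_le0 => H.
by apply: le_lt_trans h_gt; rewrite ler_pdivlMr// mulrC.
Qed.

Let cV : continuous V := locally_lipschitz_continuous V_lip.
Let W := depth V h.
Let T := [set x | h <= V x].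

(** The competitor is uniform straight motion in unit time from 0 to a fixed point [x0] of [T]. The
    choice [tau] = 1/(k+1) lets it end exactly at [x0], at a cost bounded independently of [k]. *)
Lemma exists_low_chain : exists A : R, 0 <= A /\ forall k : nat,
  let tau := (k.+1%:R : R)^-1 in
  exists N (u : nat -> 'rV[R]_n), min_chain (jcost tau (tau ^+ 2) W) T N u /\
    action (jcost tau (tau ^+ 2) W) u N <= A.
Proof.
have [r rP] := V3.
have [Wm WmP] := depth_bounded cV rP.
pose x0 : 'rV[R]_n := const_mx r.
have Tx0 : T x0.
  apply: rP; apply: le_trans (norm_le_enorm _).
  apply: le_trans (ler_norm r) _.
  by rewrite -{1}[r](_ : x0 ord0 (Ordinal n_gt0) = r) ?coord_le_norm// mxE.
have Wm0 : 0 <= Wm by apply: le_trans (WmP 0); exact: depth_ge0.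
exists (dot x0 x0 / 2 + Wm + 1); split.
  by rewrite !addr_ge0 ?divr_ge0 ?dot_ge0.
move=> k tau.
have k0 : 0 < k.+1%:R :> R by rewrite ltr0n.
have tau0 : 0 < tau by rewrite invr_gt0.
have tau1 : tau <= 1 by rewrite invf_le1// ler1n.
have e0 : 0 < tau ^+ 2 by rewrite exprn_gt0.
have Tcl : closed T.
  rewrite (_ : T = V @^-1` [set x | h <= x]) //.
  by apply: preimage_closed; [move=> ? _; exact: cV|exact: closed_ge].
pose w i := (i%:R * tau) *: x0.
have w0 : w 0%N = 0 by rewrite /w mul0r scale0r.
have wT : T (w k.+1) by rewrite /w mulfV ?gt_eqF// scale1r.
have [] := @exists_min_chain R n (jcost tau (tau ^+ 2) W) T (tau * tau ^+ 2).
- exact/jcost_continuous/depth_continuous.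
- exact: Tcl.
- by rewrite mulr_gt0.
- move=> x y; rewrite /jcost -[leLHS]add0r lerD//.
    by rewrite divr_ge0 ?dot_ge0 ?mulr_ge0 ?ltW.
  by rewrite ler_pM2l// lerDr depth_ge0.
- move=> a; exists (Num.sqrt (a * (2 * tau))) => x y xya.
  rewrite -[leLHS]ger0_norm// -sqrtr_sqr ler_wsqrtr//.
  apply: le_trans (normsq_le_dot _) _.
  rewrite -ler_pdivrMr ?mulr_gt0//; apply: le_trans xya.
  by rewrite /jcost lerDl mulr_ge0 ?(ltW tau0)// addr_ge0 ?depth_ge0 ?ltW.
- by exists k.+1, w.
move=> N [u umin]; exists N, u; split=> //.
have [_ _ /(_ k.+1 w w0 wT)] := umin => H; apply: le_trans H _.
rewrite /action.
apply: (@le_trans _ _ (\sum_(i < k.+1) tau * (dot x0 x0 / 2 + Wm + 1))).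
  apply: ler_sum => i _; rewrite /jcost.
  have -> : w i.+1 - w i = tau *: x0.
    by rewrite /w -scalerBl -natr1 mulrDl mul1r addrAC subrr add0r.
  rewrite dotZl dotZr.
  have -> : tau * (dot x0 x0 / 2 + Wm + 1) =
      tau * (tau * dot x0 x0) / (2 * tau) + tau * (Wm + 1).
    by field; rewrite gt_eqF.
  rewrite lerD2l.
  rewrite ler_pM2l// lerD ?WmP// expr2 -[leRHS]mulr1.
  by rewrite ler_pM// ltW.
rewrite sumr_const card_ord -[leLHS]mulr_natl mulrA /tau mulfV ?gt_eqF//.
by rewrite mul1r.
Qed.

(** At interior nodes V = h - W, so (V2) bounds the virial sum below by [mu1 * h - mu2 - mu1 * W]
    per node. In the constant, [mu1 * A] pays for the potential part of the action, [2 * A] for the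
    kinetic part and [n%:R * M * B] for the boundary term at the end. The hypothesis on [h] makes
    the denominator positive; [N.-1] counts the nodes where the inclusion holds. *)
Lemma min_chain_time tau e N u A M B :
  0 < tau -> 0 < e -> 0 <= B ->
  min_chain (jcost tau e W) T N u -> action (jcost tau e W) u N <= A ->
  (forall i, (i < N)%N -> `|u i.+1 - u i| <= M * tau) ->
  (forall i, (i < N)%N -> `|u i| <= B) ->
  N.-1%:R * tau <= ((mu1 + 2) * A + n%:R * M * B) / (mu1 * h - mu2).
Proof.
move=> tau0 e0 B0 umin uA uM uB.
have c0 x y : 0 < jcost tau e W x y.
  rewrite /jcost ltr_wpDl// ?divr_ge0 ?dot_ge0 ?mulr_ge0 ?ltW//.
  by rewrite mulr_gt0// ltr_wpDl// depth_ge0.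
have hit := min_chain_first_hit c0 umin.
have [u0 uT _] := umin.
have h0 : 0 < mu1 * h - mu2 by rewrite subr_gt0 mulrC -ltr_pdivrMr.
case: N umin uA uM uB hit uT => [|m] umin uA uM uB hit uT.
  have := center_inside; rewrite ltNge => /negP.
  by move: uT; rewrite /T /= u0.
rewrite ler_pdivlMr//=.
pose K := \sum_(i < m.+1) dot (u i.+1 - u i) (u i.+1 - u i).
pose P := \sum_(i < m.+1) W (u i).
have K0 : 0 <= K by apply: sumr_ge0 => i _; exact: dot_ge0.
have P0 : 0 <= P by apply: sumr_ge0 => i _; exact: depth_ge0.
have KP : K / (2 * tau) + tau * P <= A.
  apply: le_trans uA; rewrite /action /K /P mulr_suml mulr_sumr -big_split /=.
  apply: ler_sum => i _; rewrite /jcost lerD2l ler_pM2l// lerDl; exact: ltW.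
have vir := chain_virial m u0.
have low : \sum_(i < m) (tau ^+ 2 * (mu1 * h - mu2 - mu1 * W (u i.+1))) <=
    \sum_(i < m) dot (2 *: u i.+1 - u i.+2 - u i) (u i.+1).
  apply: ler_sum => i _.
  have im : (i.+1 < m.+1)%N by rewrite ltnS.
  have H := V2 (min_chain_clarke cV tau0 e0 umin im).
  have Vq : V (u i.+1) < h by rewrite ltNge; apply/negP/hit.
  rewrite /W (depth_inside (ltW Vq)).
  have tau20 : 0 < tau ^+ 2 by rewrite exprn_gt0.
  rewrite dotNl dotZl -(ler_pM2l tau20) in H.
  set S := dot _ _ in H; set S' := dot _ _.
  have -> : S' = - S.
    by rewrite /S /S' -dotNl; congr dot; apply/rowP => k; rewrite !mxE; ring.
  apply: le_trans (le_trans _ H) _.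
    rewrite le_eqVlt; apply/orP; left; apply/eqP; ring.
  by rewrite le_eqVlt; apply/orP; left; apply/eqP; field; rewrite gt_eqF.
have hi : \sum_(i < m) dot (2 *: u i.+1 - u i.+2 - u i) (u i.+1) <=
    K + n%:R * (M * tau) * B.
  rewrite vir; apply: lerD.
    by rewrite /K big_ord_recr /= lerDl dot_ge0.
  apply: le_trans (ler_norm _) _; rewrite normrN.
  apply: le_trans (dot_le_norm _ _) _.
  by rewrite ler_pM ?mulr_ge0// ?uB// ler_wpM2l// uM.
have P1 : \sum_(i < m) W (u i.+1) <= P.
  rewrite /P big_ord_recl; apply: ler_wpDl; first exact: depth_ge0.
  by apply: ler_sum => i _; rewrite lift0.
have sumE : \sum_(i < m) (tau ^+ 2 * (mu1 * h - mu2 - mu1 * W (u i.+1))) =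
    tau ^+ 2 * (m%:R * (mu1 * h - mu2)) - tau ^+ 2 * mu1 * \sum_(i < m) W (u i.+1).
  rewrite -mulr_sumr big_split /= sumr_const card_ord -mulr_natl sumrN -mulr_sumr.
  by ring.
have {}low : tau ^+ 2 * (m%:R * (mu1 * h - mu2)) <=
    tau ^+ 2 * mu1 * P + (K + n%:R * (M * tau) * B).
  have : tau ^+ 2 * mu1 * \sum_(i < m) W (u i.+1) <= tau ^+ 2 * mu1 * P.
    by rewrite ler_wpM2l// mulr_ge0 ?exprn_ge0 ?ltW.
  by rewrite sumE in low; lra.
have PA : tau * P <= A.
  by apply: le_trans KP; rewrite lerDr divr_ge0// mulr_ge0// ltW.
have KA : K / (2 * tau) <= A.
  by apply: le_trans KP; rewrite lerDl mulr_ge0// ltW.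
rewrite ler_pdivrMr ?mulr_gt0// in KA.
rewrite -(ler_pM2l tau0).
have E1 : tau * mu1 * (tau * P) <= tau * mu1 * A.
  by rewrite ler_wpM2l// mulr_ge0// ltW.
apply: (@le_trans _ _ (tau * mu1 * (tau * P) + (K + n%:R * (M * tau) * B))).
  by move: low; rewrite expr2; lra.
by lra.
Qed.

(** [min_chain_block_energy] with [m = k + 1] gives the first bound and with [m = k - 1] the second.
    A block moves at most [k%:R * (M * tau)], so the depth varies by at most L times this, and that
    error enters [k + m <= 2 k + 1] times. *)
Lemma min_chain_energy tau e N u L d M B j k :
  0 < tau -> 0 < e -> 0 <= L ->
  (forall q x z, `|q| <= B -> `|x - q| < d -> `|z - q| < d ->
      `|V x - V z| <= L * `|x - z|) ->
  min_chain (jcost tau e W) T N u ->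
  (forall i, (i <= N)%N -> `|u i| <= B) ->
  (forall i, (i < N)%N -> `|u i.+1 - u i| <= M * tau) ->
  (1 < k)%N -> (j + k <= N)%N -> 0 <= M -> k%:R * (M * tau) < d ->
  let D := u (j + k)%N - u j in
  let r := dot D D / (k%:R * tau) ^+ 2 in
  let E := e + (2 * k%:R + 1) * (L * (k%:R * (M * tau))) in
  r / 2 * (k%:R / (k%:R + 1)) <= h - V (u j) + E /\
  h - V (u j) <= r / 2 * (k%:R / (k%:R - 1)) + E.
Proof.
move=> tau0 e0 L0 VL umin uB uM k1 jkN M0 kd D r E.
have Mtau0 : 0 <= M * tau by rewrite mulr_ge0// ltW.
have c0 x y : 0 < jcost tau e W x y.
  rewrite /jcost ltr_wpDl// ?divr_ge0 ?dot_ge0 ?mulr_ge0 ?ltW//.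
  by rewrite mulr_gt0// ltr_wpDl// depth_ge0.
have jN : (j < N)%N by lia.
have Vj : V (u j) < h by rewrite ltNge; apply/negP/(min_chain_first_hit c0 umin).
have d0 : 0 < d by apply: le_lt_trans kd; rewrite mulr_ge0.
have dist := chain_dist uM.
pose om := L * (k%:R * (M * tau)).
have om0 : 0 <= om by rewrite /om !mulr_ge0// ltW.
have near x : `|x - u j| <= k%:R * (M * tau) -> `|W x - W (u j)| <= om.
  move=> xu; apply: le_trans (depth_dist _ _ _ _) _.
  apply: le_trans (VL (u j) _ _ _ _ _) _; rewrite ?subrr ?normr0 ?uB ?(ltnW jN)//.
    exact: le_lt_trans xu kd.
  by rewrite ler_wpM2l.
have Dle : `|D| <= k%:R * (M * tau) by apply: dist.
have Wlo i : (i <= k)%N -> W (u j) - om <= W (u (j + i)%N).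
  move=> ik; have := near (u (j + i)%N).
  have : `|u (j + i)%N - u j| <= k%:R * (M * tau).
    apply: le_trans (dist _ _ _) _.
      by apply: leq_trans jkN; rewrite leq_add2l.
    by rewrite ler_wpM2r// ler_nat.
  by move=> /[swap] /[apply]; rewrite ler_norml => /andP[]; lra.
have Whi t : 0 <= t <= 1 -> W (u j + t *: D) <= W (u j) + om.
  move=> /andP[t0 t1]; have := near (u j + t *: D).
  have : `|u j + t *: D - u j| <= k%:R * (M * tau).
    rewrite addrAC subrr add0r normrZ ger0_norm//; apply: le_trans Dle.
    by rewrite ler_piMl.
  by move=> /[swap] /[apply]; rewrite ler_norml => /andP[]; lra.
have bl m (m0 : (0 < m)%N) := min_chain_block_energy tau0 umin (ltnW k1) m0 jkN Wlo Whi.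
rewrite -/D -/r in bl.
have WV : W (u j) = h - V (u j) by rewrite /W depth_inside// ltW.
have kR : 1 < k%:R :> R by rewrite ltr1n.
have k1R : 0 < k%:R - 1 :> R by rewrite subr_gt0.
split.
  have kS : k.+1%:R = k%:R + 1 :> R by rewrite -natr1.
  have := bl k.+1 isT; rewrite WV kS => H.
  have -> : r / 2 * (k%:R / (k%:R + 1)) =
      k%:R * (r / 2) - r * k%:R ^+ 2 / (2 * (k%:R + 1)).
    by field; rewrite gt_eqF// addr_gt0// (lt_trans ltr01).
  by rewrite /E -/om; lra.
have k10 : (0 < k.-1)%N by case: (k) k1 => [|[]].
have := bl _ k10; rewrite WV => H.
have kE : k.-1%:R = k%:R - 1 :> R by rewrite -subn1 natrB// ltnW.
rewrite kE in H.
have -> : r / 2 * (k%:R / (k%:R - 1)) =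
    r * k%:R ^+ 2 / (2 * (k%:R - 1)) - k%:R * (r / 2).
  by field; rewrite gt_eqF.
by rewrite /E -/om; lra.
Qed.

Lemma exists_good_chains : exists B M C c L d : R,
  [/\ 0 < M, 0 < C, 0 < c, 0 <= L & 0 < d] /\
  exists k0 : nat, forall k, (k0 <= k)%N ->
    exists N u, good_chain V h B M C c L d (k.+1%:R^-1) N u.
Proof.
have [A [A0 lowP]] := exists_low_chain.
have [r rP] := V3.
have [Wm WmP] := depth_bounded cV rP.
have Wm0 : 0 <= Wm by apply: le_trans (WmP 0); exact: depth_ge0.
(* The speed bound is the square root of [4 * (Wm + 1)]; since [Wm + 1 >= 1], this [M] dominates
   it. *)
pose M := 2 * (Wm + 1).
have M0 : 0 < M by rewrite mulr_gt0// ltr_wpDl.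
(* All nodes but the last satisfy V < h and so have norm at most [|r|]; the last lies at most one
   step, of length at most [M], further. *)
pose B := `|r| + M.
have B0 : 0 <= B by rewrite addr_ge0// ltW.
have [L [d [L0 d0 VL]]] := locally_lipschitz_ball B V_lip.
have [rho rho0 rhoP] := continuous_lt_ball cV center_inside.
have h0 : 0 < mu1 * h - mu2 by rewrite subr_gt0 mulrC -ltr_pdivrMr.
pose T1 := ((mu1 + 2) * A + n%:R * M * B) / (mu1 * h - mu2).
have T10 : 0 <= T1.
  by rewrite divr_ge0 ?(ltW h0)// addr_ge0 ?mulr_ge0 ?(ltW M0)// addr_ge0// ltW.
(* [T1 + 1] bounds the duration, including the one step that [N.-1] omits; [2 * L + 2] is for the
   last step, and it also covers the bound [L] on second differences. *)
pose C := T1 + 1 + (2 * L + 2).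
(* A chain of speed at most [M] needs time at least [rho / M] to leave the ball of radius [rho]
   about 0, where V < h. *)
exists B, M, C, (rho / M), L, d; split.
  split=> //; last by rewrite divr_gt0.
  by rewrite /C; lra.
(* From this index on a single step is shorter than [d], so the Lipschitz bound applies across the
   last step. *)
exists (Num.bound (M / d)) => k k0k.
set tau := k.+1%:R^-1.
have tau0 : 0 < tau by rewrite invr_gt0 ltr0n.
have tau1 : tau <= 1 by rewrite invf_le1// ?ltr0n// ler1n.
have Mtau0 : 0 < M * tau by rewrite mulr_gt0.
have MtauM : M * tau <= M by rewrite ler_piMr// ltW.
have Mtaud : M * tau < d.
  rewrite /tau ltr_pdivrMr ?ltr0n// mulrC -ltr_pdivrMr//.
  apply: lt_le_trans (archi_boundP _) _; first by rewrite divr_ge0// ltW.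
  by rewrite ler_nat ltnW.
have [N [u [umin uA]]] := lowP k; rewrite -/tau in umin uA.
exists N, u.
have e0 : 0 < tau ^+ 2 by rewrite exprn_gt0.
have e1 : tau ^+ 2 <= 1 by rewrite expr_le1// ltW.
have c0 x y : 0 < jcost tau (tau ^+ 2) W x y.
  rewrite /jcost ltr_wpDl// ?divr_ge0 ?dot_ge0 ?mulr_ge0 ?ltW//.
  by rewrite mulr_gt0// ltr_wpDl// depth_ge0.
have hit i (iN : (i < N)%N) : V (u i) < h.
  by rewrite ltNge; apply/negP/(min_chain_first_hit c0 umin iN).
have [u0 uT _] := umin.
have N0 : (0 < N)%N.
  case: N uT {umin uA hit} => // uT; have := center_inside.
  by rewrite ltNge => /negP; move: uT; rewrite /T /= u0.
have uM i : (i < N)%N -> `|u i.+1 - u i| <= M * tau.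
  move=> iN; apply: le_of_sqr_le; first exact: ltW.
  apply: le_trans (normsq_le_dot _) _.
  apply: le_trans (min_chain_speed tau0 umin iN) _.
  apply: (@le_trans _ _ (4 * tau ^+ 2 * (Wm + 1))).
    by rewrite ler_wpM2l ?lerD ?WmP// mulr_ge0// ltW.
  have -> : (M * tau) ^+ 2 = 4 * tau ^+ 2 * (Wm + 1) ^+ 2 by rewrite /M; ring.
  apply: ler_wpM2l; first by rewrite mulr_ge0// ltW.
  by rewrite expr2 ler_peMl ?addr_ge0// lerDr.
have uB' i : (i < N)%N -> `|u i| <= `|r|.
  move=> iN; rewrite leNgt; apply/negP => ur.
  have : h <= V (u i).
    apply: rP; apply: le_trans (ler_norm _) _; apply: le_trans (ltW ur) _.
    exact: norm_le_enorm.
  by rewrite leNgt hit.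
have uB i : (i <= N)%N -> `|u i| <= B.
  rewrite leq_eqVlt => /orP[/eqP->|iN]; last first.
    by rewrite (le_trans (uB' _ iN))// lerDl ltW.
  rewrite -(subrK (u N.-1) (u N)) addrC; apply: le_trans (ler_normD _ _) _.
  rewrite /B lerD ?uB' ?prednK//; apply: le_trans MtauM.
  by have := uM N.-1; rewrite prednK//; apply.
have dist := chain_dist uM.
split=> //.
- apply/andP; split.
    rewrite ler_pdivrMr// -mulrA (mulrC tau) leNgt; apply/negP => H.
    have := dist 0%N N (leqnn N); rewrite add0n u0 subr0 => /le_lt_trans/(_ H).
    move=> uNr; have := rhoP (u N); rewrite subr0 => /(_ uNr).
    by rewrite ltNge => /negP; apply.
  have := min_chain_time tau0 e0 B0 umin uA uM (fun i iN => uB i (ltnW iN)).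
  rewrite -/T1 => H.
  have -> : N%:R * tau = N.-1%:R * tau + tau.
    by rewrite -[in LHS](prednK N0) -natr1 mulrDl mul1r.
  by rewrite /C; lra.
- move=> i iN.
  have yV := min_chain_clarke cV tau0 e0 umin iN.
  have := clarke_gradient_norm d0 L0 (fun x z => VL _ x z (uB _ (ltnW iN))) yV.
  rewrite normrN normrZ gtr0_norm ?invr_gt0// ler_pdivrMl// mulrC => H.
  by apply: le_trans H _; rewrite ler_wpM2r ?(ltW e0)// /C; lra.
- move=> i iN; have iN' : (i < N)%N by rewrite -iN.
  set D := u i.+1 - u i.
  have Dd : `|D| <= M * tau by exact: uM.
  (* The depth vanishes at the end node, hence is small at the midpoint of the last step, where
     [min_chain_speed] evaluates it. *)
  have Wmid : W (u i + 2^-1 *: D) <= L * (`|D| / 2).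
    have WN : W (u N) = 0 by rewrite /W depth_outside.
    rewrite -[leLHS]subr0 -WN; apply: le_trans (ler_norm _) _.
    apply: le_trans (depth_dist _ _ _ _) _.
    have dm : `|u i + 2^-1 *: D - u N| = `|D| / 2.
      have -> : u i + 2^-1 *: D - u N = - (2^-1 *: D).
        by rewrite -iN /D; apply/rowP => l; rewrite !mxE; field.
      by rewrite normrN normrZ gtr0_norm// mulrC.
    rewrite -dm; apply: (VL (u N)); rewrite ?subrr ?normr0 ?uB//.
    rewrite dm; apply: le_lt_trans Mtaud; apply: le_trans Dd.
    by rewrite ler_pdivrMr// mulr_natr mulr2n lerDl.
  have sq : `|D| ^+ 2 <= 4 * tau ^+ 2 * (L * (`|D| / 2) + tau ^+ 2).
    apply: le_trans (normsq_le_dot _) _.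
    apply: le_trans (min_chain_speed tau0 umin iN') _.
    by rewrite ler_wpM2l ?lerD// mulr_ge0// ltW.
  (* With a = |D| and t = tau^2, [sq] reads a^2 <= 2 L t a + 4 t^2. If a > (2 L + 2) t, then 2 t <=
     a, so the right side is at most (2 L + 2) t a < a^2. *)
  have Dt : `|D| <= (2 * L + 2) * tau ^+ 2.
    set a := `|D| in sq *; set t := tau ^+ 2 in sq e0 *.
    rewrite leNgt; apply/negP => H.
    have a0 : 0 < a by apply: le_lt_trans H; rewrite mulr_ge0 ?(ltW e0)//; lra.
    have H1 : (2 * L + 2) * t * a < a * a by rewrite ltr_pM2r.
    have t2a : 2 * t <= a by apply: ltW; apply: le_lt_trans H; rewrite ler_pM2r//; lra.
    have H2 : 2 * t * (2 * t) <= 2 * t * a by rewrite ler_wpM2l// mulr_ge0// ltW.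
    by move: sq; rewrite expr2; lra.
  by apply: le_trans Dt _; rewrite ler_wpM2r ?(ltW e0)// /C; lra.
- by move=> i iN; exact: (min_chain_clarke cV tau0 e0 umin iN).
- move=> j k' k1 jkN kd.
  exact: (min_chain_energy tau0 e0 L0 VL umin uB uM k1 jkN (ltW M0) kd).
Qed.

End good_chains.

(** * Symmetric extension to a periodic discrete orbit *)

Definition odd_extension (V : zmodType) (u : nat -> V) (i : int) : V :=
  if 0 <= i then u `|i|%N else - u `|i|%N.

(* The extension of u from [0, N] that is odd about 0 and even about N; r - N is
   the representative of i modulo 4 N in [- N, 3 N). *)
Definition brake_extension (V : zmodType) (N : nat) (u : nat -> V) (i : int) : V :=
  let r := ((i + N%:Z) %% (4 * N)%N%:Z)%Z in
  odd_extension u (if r <= 2 * N%:Z then r - N%:Z else 3 * N%:Z - r).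

Section brake_extension.
Variables (V : zmodType) (N : nat) (u : nat -> V).
Hypotheses (N0 : (0 < N)%N) (u0 : u 0%N = 0).
Let U := brake_extension N u.

Lemma odd_extensionN i : odd_extension u (- i) = - odd_extension u i.
Proof.
rewrite /odd_extension abszN.
have [->|i0] := eqVneq i 0; first by rewrite oppr0 lexx absz0 u0 oppr0.
have [ilt|ile] := leP 0 i.
  by rewrite ifF//; lia.
by rewrite (_ : (0 <= - i) = true) ?opprK//; lia.
Qed.

Lemma odd_extension_nat (j : nat) : odd_extension u j = u j.
Proof. by []. Qed.

Lemma brake_extension_up (q s : int) : - N%:Z <= s <= N%:Z ->
  U (q * (4 * N)%N%:Z + s) = odd_extension u s.
Proof.
move=> sN; rewrite /U /brake_extension -addrA modzMDl modz_small; last by lia.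
by rewrite ifT; [congr odd_extension|]; lia.
Qed.

Lemma brake_extension_down (q s : int) : N%:Z <= s <= 3 * N%:Z ->
  U (q * (4 * N)%N%:Z + s) = odd_extension u (2 * N%:Z - s).
Proof.
(* The endpoint [s = 3 N] already belongs to the next period, as its index [- N]. *)
move=> sN; have [->|sN3] := eqVneq s (3 * N%:Z).
  rewrite (_ : _ + _ = (q + 1) * (4 * N)%N%:Z + - N%:Z); last by lia.
  by rewrite brake_extension_up; [congr odd_extension|]; lia.
rewrite /U /brake_extension -addrA modzMDl modz_small; last by lia.
have [->|sN1] := eqVneq s N%:Z.
  by rewrite ifT; [congr odd_extension|]; lia.
by rewrite ifF; [congr odd_extension|]; lia.
Qed.

Lemma brake_extension_decomp (i : int) : exists q s : int,
  i = q * (4 * N)%N%:Z + s /\ - N%:Z <= s < 3 * N%:Z.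
Proof.
exists (((i + N%:Z) %/ (4 * N)%N%:Z)%Z), (((i + N%:Z) %% (4 * N)%N%:Z)%Z - N%:Z).
have p0 : 0 < (4 * N)%N%:Z by lia.
have p0' : (4 * N)%N%:Z != 0 by lia.
have h1 := divz_eq (i + N%:Z) (4 * N)%N%:Z.
have h2 := modz_ge0 (i + N%:Z) p0'.
have h3 := ltz_pmod (i + N%:Z) p0.
move: h1 h2 h3; set m := modz _ _; set d := (divz _ _ * _)%R; lia.
Qed.

Lemma brake_extension_periodic i : U (i + (4 * N)%N%:Z) = U i.
Proof.
rewrite /U /brake_extension.
by rewrite (_ : i + _ + _ = 1 * (4 * N)%N%:Z + (i + N%:Z)) ?modzMDl//; lia.
Qed.

Lemma brake_extensionN i : U (- i) = - U i.
Proof.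
have [q [s [-> /andP[s1 s2]]]] := brake_extension_decomp i.
have [sN|sN] := leP s N%:Z.
  rewrite (_ : - _ = (- q) * (4 * N)%N%:Z + - s); last by lia.
  by rewrite !brake_extension_up ?odd_extensionN//; lia.
rewrite (_ : - _ = (- q - 1) * (4 * N)%N%:Z + (4 * N%:Z - s)); last by lia.
rewrite !brake_extension_down; [|lia|lia].
by rewrite -odd_extensionN; congr odd_extension; lia.
Qed.

Lemma brake_extension_reflect i : U (2 * N%:Z - i) = U i.
Proof.
have [q [s [-> /andP[s1 s2]]]] := brake_extension_decomp i.
rewrite (_ : _ - _ = (- q) * (4 * N)%N%:Z + (2 * N%:Z - s)); last by lia.
have [sN|sN] := leP s N%:Z.
  rewrite (@brake_extension_down (- q) (2 * N%:Z - s)); last first.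
    by lia.
  by rewrite brake_extension_up; [congr odd_extension|]; lia.
rewrite (@brake_extension_up (- q) (2 * N%:Z - s)); last by lia.
by rewrite (@brake_extension_down q s)//; lia.
Qed.

Lemma brake_extension_nat (j : nat) : (j <= N)%N -> U j = u j.
Proof.
move=> jN; rewrite -[j%:Z]add0r -(mul0r (4 * N)%N%:Z) brake_extension_up; last by lia.
exact: odd_extension_nat.
Qed.

(** The symmetries carry every index to some [j] in [0, N]: [s] records a reversal of time and [t] a
    change of sign. As the identity holds for all [d], whole difference stencils and blocks around
    [i] are carried along. Only turning points fold to [N]. *)
Lemma brake_extension_fold (i : int) : exists (j : nat) (s t : bool),
  [/\ (j <= N)%N, j = N -> exists k : int, i = N%:Z + 2 * N%:Z * k &
    forall d : int, U (i + d) =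
      (if t then - U (if s then j%:Z - d else j%:Z + d)
       else U (if s then j%:Z - d else j%:Z + d))].
Proof.
pose p := (4 * N)%N%:Z.
have per (q x : int) : U (q * p + x) = U x.
  have [q' [s [-> /andP[s1 s2]]]] := brake_extension_decomp x.
  rewrite addrA -mulrDl; have [sN|sN] := leP s N%:Z.
    by rewrite (@brake_extension_up (q + q') s) ?(@brake_extension_up q' s)//; lia.
  by rewrite (@brake_extension_down (q + q') s) ?(@brake_extension_down q' s)//; lia.
have [q [s [-> /andP[s1 s2]]]] := brake_extension_decomp i.
have [sN|sN] := leP s N%:Z; last first.
  have [s2N|s2N] := leP s (2 * N%:Z).
    exists `|(2 * N%:Z - s)%R|%N, true, false; split; [lia|lia|].
    move=> d; rewrite -addrA per -brake_extension_reflect; congr U; lia.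
  exists `|(s - 2 * N%:Z)%R|%N, false, true; split; [lia| |].
    by move=> E; exists (2 * q + 1); rewrite (_ : s = 3 * N%:Z); lia.
  move=> d; rewrite -addrA per -brake_extension_reflect -[X in U X]opprK brake_extensionN.
  by congr (- U _); lia.
have [s0|s0] := leP 0 s.
  exists `|s|%N, false, false; split; [lia| |].
    by move=> E; exists (2 * q); rewrite (_ : s = N%:Z); lia.
  by move=> d; rewrite -addrA per; congr U; lia.
exists `|(- s)%R|%N, true, true; split; [lia| |].
  by move=> E; exists (2 * q - 1); rewrite (_ : s = - N%:Z); lia.
move=> d; rewrite -addrA per -[X in U X]opprK brake_extensionN.
by congr (- U _); lia.
Qed.

End brake_extension.

(* Nothing is known about the inclusion at the turning points i = N mod 2 N. *)
Record good_orbit (R : realType) n (V : 'rV[R]_n -> R) (h B M C c L d tau : R)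
    (N : nat) (U : int -> 'rV[R]_n) : Prop := GoodOrbit {
  go_start : U 0 = 0;
  go_periodic : forall i, U (i + (4 * N)%N%:Z) = U i;
  go_time : c <= N%:R * tau <= C;
  go_bound : forall i, `|U i| <= B;
  go_step : forall i, `|U (i + 1) - U i| <= M * tau;
  go_second : forall i, `|U (i + 1) - 2 *: U i + U (i - 1)| <= 2 * C * tau ^+ 2;
  go_clarke : forall i, (exists k : int, i = N%:Z + 2 * N%:Z * k) \/
    clarke_gradient V (U i) (- (tau ^- 2 *: (U (i + 1) - 2 *: U i + U (i - 1))));
  go_energy : forall (i : int) (k : nat), (1 < k)%N -> (k <= N)%N ->
    k%:R * (M * tau) < d ->
    exists a b : int, [/\ `|a - i| <= k%:Z, b = a + k%:Z \/ b = a - k%:Z &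
    let D := U b - U a in
    let r := dot D D / (k%:R * tau) ^+ 2 in
    let E := tau ^+ 2 + (2 * k%:R + 1) * (L * (k%:R * (M * tau))) in
    r / 2 * (k%:R / (k%:R + 1)) <= h - V (U a) + E /\
    h - V (U a) <= r / 2 * (k%:R / (k%:R - 1)) + E]
}.

(** A block of [k] steps from [j] may overrun the end [N]; shifting its start back by at most [k]
    keeps it inside the chain. *)
Lemma block_position (j k N : nat) : (k <= N)%N -> (j <= N)%N ->
  exists (j' : nat) (p : int), [/\ j%:Z + p = j'%:Z,
    j%:Z + (p + k%:Z) = (j' + k)%N%:Z, (j' + k <= N)%N & `|p| <= k%:Z].
Proof.
move=> kN jN; exists (minn j (N - k)), ((minn j (N - k))%:Z - j%:Z).
by split; lia.
Qed.

(** Folding reduces all claims to nodes of the chain. At 0 oddness makes the second difference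
    vanish, and 0 is a gradient there by evenness of V. At [N] the second difference is minus twice
    the last step, whence [2 * C]. Energy blocks are shifted to fit into the chain and may be
    traversed backwards, whence the freedom of [a] and [b] in [go_energy]. *)
Lemma good_orbit_of_chain (R : realType) n (V : 'rV[R]_n -> R)
    (h B M C c L d tau : R) (N : nat) (u : nat -> 'rV[R]_n) :
  (forall q, V (- q) = V q) -> 0 < C -> 0 < tau -> 0 < c ->
  good_chain V h B M C c L d tau N u ->
  good_orbit V h B M C c L d tau N (brake_extension N u).
Proof.
move=> V1 C0 tau0 c0 [u0 uT uB uM uS uL uC uE].
have N0 : (0 < N)%N.
  by case: (N) uT => // /andP[]; rewrite mul0r => /(lt_le_trans c0); rewrite ltxx.
set U := brake_extension N u.
have Unat j : (j <= N)%N -> U j = u j by exact: brake_extension_nat.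
have UN i : U (- i) = - U i by exact: brake_extensionN.
have Ur i : U (2 * N%:Z - i) = U i by exact: brake_extension_reflect.
have t20 : 0 < tau ^+ 2 by rewrite exprn_gt0.
have fold (i : int) : exists (j : nat) (s t : bool),
    [/\ (j <= N)%N, j = N -> exists k : int, i = N%:Z + 2 * N%:Z * k &
    forall d : int, U (i + d) =
      (if t then - U (if s then j%:Z - d else j%:Z + d)
       else U (if s then j%:Z - d else j%:Z + d))].
  exact: (brake_extension_fold N0 u0 i).
have C2 : C * tau ^+ 2 <= 2 * C * tau ^+ 2.
  by rewrite ler_pM2r// mulr_natl mulr2n lerDl ltW.
have U1 : U (-1) = - u 1%N by rewrite UN Unat.
have UNN : U (N%:Z + 1) = u N.-1.
  by rewrite -Ur (_ : _ - _ = N.-1%:Z) ?Unat ?leq_pred//; lia.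
have Uin (j : nat) : (j.+1 < N)%N ->
    U (j.+1%:Z + 1) - 2 *: U j.+1 + U (j.+1%:Z - 1) = u j.+2 - 2 *: u j.+1 + u j.
  move=> jN; rewrite (_ : j.+1%:Z + 1 = j.+2%:Z); last by lia.
  rewrite (_ : j.+1%:Z - 1 = j%:Z); last by lia.
  by rewrite !Unat//; lia.
have S0 : U (0 + 1) - 2 *: U 0 + U (0 - 1) = 0.
  by rewrite add0r sub0r U1 !Unat// u0 scaler0 subr0 subrr.
have SN : U (N%:Z + 1) - 2 *: U N + U (N%:Z - 1) = - (2 *: (u N.-1.+1 - u N.-1)).
  rewrite UNN (_ : N%:Z - 1 = N.-1%:Z); last by lia.
  rewrite !Unat ?leq_pred// prednK//.
  by apply/rowP => l; rewrite !mxE; ring.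
have Sfold i (j : nat) (s t : bool) : (forall d : int, U (i + d) =
      (if t then - U (if s then j%:Z - d else j%:Z + d)
       else U (if s then j%:Z - d else j%:Z + d))) ->
    U (i + 1) - 2 *: U i + U (i - 1) =
    if t then - (U (j%:Z + 1) - 2 *: U j + U (j%:Z - 1))
    else U (j%:Z + 1) - 2 *: U j + U (j%:Z - 1).
  move=> H; rewrite !H -[in U i](addr0 i) H.
  case: t {H}; case: s; rewrite ?subr0 ?addr0 ?opprK;
    by apply/rowP => l; rewrite !mxE; ring.
split=> //.
- by rewrite Unat.
- exact: brake_extension_periodic.
- move=> i; have [j [s [t [jN _ H]]]] := fold i.
  rewrite -[i]addr0 H; case: s {H}; rewrite ?subr0 ?addr0;
    by case: t; rewrite ?normrN Unat// uB.
- move=> i; have [j [s [t [jN _ H]]]] := fold i.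
  have st : forall x : int, x = j%:Z + 1 \/ x = j%:Z - 1 -> `|U x - U j| <= M * tau.
    move=> x [->|->]; rewrite (Unat j)//.
      have [jN'|jN'] := ltnP j N.
        rewrite (_ : j%:Z + 1 = j.+1%:Z); last by lia.
        by rewrite Unat// uM.
      rewrite (_ : j = N); last by lia.
      by rewrite UNN distrC -[X in u X - _](prednK N0) uM// prednK.
    case: (j) jN => [|j'] jN.
      by rewrite sub0r U1 u0 subr0 normrN -[u 1%N]subr0 -u0 uM.
    rewrite (_ : j'.+1%:Z - 1 = j'%:Z); last by lia.
    by rewrite Unat ?(ltnW jN)// distrC uM.
  have H0 := H 0; rewrite addr0 in H0; rewrite H H0.
  case: s {H H0}; rewrite ?subr0 ?addr0; case: t.
  - by rewrite -opprD normrN; apply: st; right.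
  - by apply: st; right.
  - by rewrite -opprD normrN; apply: st; left.
  - by apply: st; left.
- move=> i; have [j [s [t [jN _ H]]]] := fold i.
  rewrite (Sfold _ _ _ _ H).
  suff : `|U (j%:Z + 1) - 2 *: U j + U (j%:Z - 1)| <= 2 * C * tau ^+ 2.
    by case: (t); rewrite ?normrN.
  have [->|] := eqVneq j 0%N; first by rewrite S0 normr0 ltW// !mulr_gt0.
  have [->|] := eqVneq j N.
    rewrite SN normrN normrZ ger0_norm// -mulrA ler_pM2l//.
    by move=> _; apply: uL; rewrite prednK.
  case: j jN {H} => // j jN jN' _; rewrite Uin; last by lia.
  by apply: le_trans (uS _ _) C2; lia.
- move=> i; have [j [s [t [jN jbad H]]]] := fold i.
  have [jE|jN'] := eqVneq j N; first by left; exact: jbad.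
  right; rewrite (Sfold _ _ _ _ H).
  have -> : U i = if t then - U j else U j.
    by rewrite -[i]addr0 H; case: (s); rewrite ?subr0 ?addr0.
  suff yV : clarke_gradient V (U j)
      (- (tau ^- 2 *: (U (j%:Z + 1) - 2 *: U j + U (j%:Z - 1)))).
    by case: (t) => //; rewrite scalerN; exact: clarke_gradient_even.
  have [->|] := eqVneq j 0%N.
    by rewrite S0 Unat// u0 scaler0 oppr0; exact: clarke_gradient0_even.
  case: j jN jN' {H jbad} => // j jN jN' _; rewrite Uin; last by lia.
  by rewrite Unat//; apply: uC; lia.
- move=> i k k1 kN kd; have [j [s [t [jN _ H]]]] := fold i.
  have [j' [p [e1 e2 j'N pk]]] := block_position kN jN.
  have [H1 H2] := uE j' k k1 j'N kd.
  have jN' : (j' <= N)%N := leq_trans (leq_addr _ _) j'N.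
  exists (if s then i - p else i + p), (if s then i - (p + k%:Z) else i + (p + k%:Z)).
  have EA : U (if s then i - p else i + p) = if t then - u j' else u j'.
    by case: (s) H => H; rewrite H ?opprK e1 (Unat _ jN').
  have EB : U (if s then i - (p + k%:Z) else i + (p + k%:Z)) =
      if t then - u (j' + k)%N else u (j' + k)%N.
    by case: (s) H => H; rewrite H ?opprK e2 (Unat _ j'N).
  split.
  + by case: (s); rewrite addrAC subrr add0r ?normrN.
  + by case: (s); [right; rewrite opprD addrA|left; rewrite addrA].
  + rewrite EA EB; case: (t) => //.
    rewrite /= (_ : - u (j' + k)%N - - u j' = - (u (j' + k)%N - u j')); last by rewrite opprD.
    by rewrite dotNl dotNr opprK V1.
Qed.

(** * Estimates along a discrete orbit *)

Lemma int_dist_nat (i j : int) : exists m : nat, j = i + m%:Z \/ i = j + m%:Z.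
Proof.
have [ij|ij] := leP i j; first by exists `|(j - i)%R|%N; left; lia.
by exists `|(i - j)%R|%N; right; lia.
Qed.


Definition disc_vel (R : realType) n (tau : R) (U : int -> 'rV[R]_n) (i : int) :=
  tau^-1 *: (U (i + 1) - U i).

(** The exceptional increment at [l0], if it occurs below [m], costs at most [b - a] more than the
    others. *)
Lemma sum_increments_le (R : realType) (g : nat -> R) (a b : R) (m l0 : nat) :
  0 <= b -> (forall l, (l < m)%N -> l != l0 -> g l.+1 - g l <= a) ->
  (g l0.+1 - g l0 <= b) -> g m - g 0%N <= m%:R * a + (b + `|a|).
Proof.
move=> b0 ga gb.
have H k : (k <= m)%N -> g k - g 0%N <= k%:R * a + (l0 < k)%N%:R * (b - a).
  elim: k => [|k IH] km; first by rewrite subrr mul0r mul0r addr0.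
  have {}IH := IH (ltnW km).
  have [E|kl] := eqVneq k l0.
    rewrite -E ltnSn mul1r -natr1 mulrDl mul1r.
    rewrite -E ltnn mul0r addr0 in IH; rewrite -E in gb.
    by lra.
  have := ga k km kl.
  rewrite ltnS leq_eqVlt eq_sym (negbTE kl) /= -natr1 mulrDl mul1r.
  by lra.
apply: le_trans (H m (leqnn m)) _; rewrite lerD2l.
case: (l0 < m)%N; rewrite ?mul1r ?mul0r ?addr_ge0//.
by rewrite lerD2l -normrN ler_norm.
Qed.

Section good_orbit.
Variables (R : realType) (n : nat) (V : 'rV[R]_n -> R).
Variables (h B M C c L d tau : R) (N : nat) (U : int -> 'rV[R]_n).
Hypotheses (tau0 : 0 < tau) (M0 : 0 < M) (C0 : 0 < C).
Hypothesis gU : good_orbit V h B M C c L d tau N U.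
Let v := disc_vel tau U.

Lemma disc_velE i : tau *: v i = U (i + 1) - U i.
Proof. by rewrite /v /disc_vel scalerA mulfV ?gt_eqF// scale1r. Qed.

Lemma disc_vel_diff i : v (i + 1) - v i =
  tau^-1 *: (U (i + 1 + 1) - 2 *: U (i + 1) + U (i + 1 - 1)).
Proof.
rewrite /v /disc_vel -scalerBr addrK; congr (_ *: _).
by apply/rowP => k; rewrite !mxE; ring.
Qed.

Lemma disc_vel_le i : `|v i| <= M.
Proof.
rewrite normrZ gtr0_norm ?invr_gt0// mulrC ler_pdivrMr//; exact: (go_step gU).
Qed.

Lemma disc_vel_step i : `|v (i + 1) - v i| <= 2 * C * tau.
Proof.
rewrite disc_vel_diff normrZ gtr0_norm ?invr_gt0// mulrC ler_pdivrMr//.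
rewrite (_ : 2 * C * tau * tau = 2 * C * tau ^+ 2); last by ring.
exact: (go_second gU).
Qed.

Lemma disc_vel_nat i (m : nat) : `|v (i + m%:Z) - v i| <= m%:R * (2 * C * tau).
Proof.
elim: m => [|m IH]; first by rewrite addr0 subrr normr0 mul0r.
rewrite (_ : i + m.+1%:Z = (i + m%:Z) + 1); last by lia.
rewrite -(subrK (v (i + m%:Z)) (v _)) -addrA -natr1 mulrDl mul1r addrC.
by apply: le_trans (ler_normD _ _) (lerD _ _) => //; exact: disc_vel_step.
Qed.

Lemma disc_pos_nat i (m : nat) : `|U (i + m%:Z) - U i| <= m%:R * (M * tau).
Proof.
elim: m => [|m IH]; first by rewrite addr0 subrr normr0 mul0r.
rewrite (_ : i + m.+1%:Z = (i + m%:Z) + 1); last by lia.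
rewrite -(subrK (U (i + m%:Z)) (U _)) -addrA -natr1 mulrDl mul1r addrC.
by apply: le_trans (ler_normD _ _) (lerD _ _) => //; exact: (go_step gU).
Qed.

Lemma normr_natz (m : nat) : `|m%:Z%:~R| = m%:R :> R.
Proof. by rewrite ger0_norm. Qed.

Lemma disc_vel_lip i j : `|v j - v i| <= `|(j - i)%:~R| * (2 * C * tau).
Proof.
have [m [->|->]] := int_dist_nat i j.
  by rewrite addrAC subrr add0r normr_natz disc_vel_nat.
by rewrite opprD addrA subrr add0r rmorphN normrN normr_natz distrC disc_vel_nat.
Qed.

Lemma disc_pos_lip i j : `|U j - U i| <= `|(j - i)%:~R| * (M * tau).
Proof.
have [m [->|->]] := int_dist_nat i j.
  by rewrite addrAC subrr add0r normr_natz disc_pos_nat.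
by rewrite opprD addrA subrr add0r rmorphN normrN normr_natz distrC disc_pos_nat.
Qed.

Lemma disc_taylor_nat i (m : nat) :
  `|U (i + m%:Z) - U i - (m%:R * tau) *: v i| <= 2 * C * (m%:R * tau) ^+ 2.
Proof.
elim: m => [|m IH].
  by rewrite addr0 subrr !mul0r scale0r subr0 normr0 expr0n mulr0.
rewrite (_ : i + m.+1%:Z = (i + m%:Z) + 1); last by lia.
have -> : U (i + m%:Z + 1) - U i - (m.+1%:R * tau) *: v i =
    U (i + m%:Z) - U i - (m%:R * tau) *: v i + tau *: (v (i + m%:Z) - v i).
  rewrite scalerBr disc_velE -natr1 mulrDl mul1r scalerDl.
  by apply/rowP => k; rewrite !mxE; ring.
apply: le_trans (ler_normD _ _) _; rewrite normrZ gtr0_norm//.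
have H : tau * `|v (i + m%:Z) - v i| <= tau * (m%:R * (2 * C * tau)).
  by rewrite ler_pM2l// disc_vel_nat.
have m0 : 0 <= m%:R :> R by [].
have E : 0 <= 2 * C * tau ^+ 2 * (m%:R + 1) 
    by rewrite !mulr_ge0 ?exprn_ge0 ?addr_ge0 ?(ltW C0) ?(ltW tau0).
apply: le_trans (lerD IH H) _; rewrite -natr1 -subr_ge0.
by apply: le_trans E _; rewrite le_eqVlt; apply/orP; left; apply/eqP; ring.
Qed.

(** Backwards, the forward estimate has its velocity at the wrong end; exchanging the velocities
    costs as much again, which doubles [2 * C]. *)
Lemma disc_taylor i j :
  `|U j - U i - ((j - i)%:~R * tau) *: v i| <= 4 * C * (`|(j - i)%:~R| * tau) ^+ 2.
Proof.
have [m [->|->]] := int_dist_nat i j.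
  rewrite (_ : i + m%:Z - i = m%:Z); last by rewrite addrAC subrr add0r.
  rewrite normr_natz; apply: le_trans (disc_taylor_nat _ _) _.
  rewrite ler_wpM2r ?exprn_ge0 ?mulr_ge0 ?(ltW tau0) ?(ltW C0) ?(ltW M0)//; have := C0; lra.
rewrite (_ : j - (j + m%:Z) = - m%:Z); last by rewrite opprD addrA subrr add0r.
rewrite rmorphN normrN normr_natz.
have -> : U j - U (j + m%:Z) - (- m%:~R * tau) *: v (j + m%:Z) =
  - (U (j + m%:Z) - U j - (m%:R * tau) *: v j) +
    (m%:R * tau) *: (v (j + m%:Z) - v j).
  by rewrite scalerBr; apply/rowP => k; rewrite !mxE -[m%:~R]/(m%:R); ring.
apply: le_trans (ler_normD _ _) _; rewrite normrN normrZ.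
rewrite ger0_norm ?mulr_ge0 ?(ltW tau0)//.
have H : m%:R * tau * `|v (j + m%:Z) - v j| <= m%:R * tau * (m%:R * (2 * C * tau)).
  by rewrite ler_wpM2l ?disc_vel_nat// mulr_ge0// ltW.
apply: le_trans (lerD (disc_taylor_nat _ _) H) _.
by rewrite le_eqVlt; apply/orP; left; apply/eqP; ring.
Qed.

(** [x] is the start of the block supplied by [go_energy] and [w] its mean velocity. Of the constant
    6, 4 comes from [disc_taylor] over the block and 2 from the change of velocity between its start
    and [i]. *)
Lemma disc_energy i (k : nat) : (1 < k)%N -> (k <= N)%N -> k%:R * (M * tau) < d ->
  exists x w : 'rV[R]_n, [/\ `|x - U i| <= k%:R * (M * tau),
    `|w - v i| <= 6 * C * (k%:R * tau) &
    let E := tau ^+ 2 + (2 * k%:R + 1) * (L * (k%:R * (M * tau))) in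
    dot w w / 2 * (k%:R / (k%:R + 1)) <= h - V x + E /\
    h - V x <= dot w w / 2 * (k%:R / (k%:R - 1)) + E].
Proof.
move=> k1 kN kd; have [a [b [ai bE H]]] := go_energy gU i k1 kN kd.
have k0 : 0 < k%:R :> R by rewrite ltr0n ltnW.
have kt0 : 0 < k%:R * tau by rewrite mulr_gt0.
have air : `|(a - i)%:~R| <= k%:R :> R.
  by rewrite -intr_norm -(ler_int R) in ai *.
(* The sign [s] corrects the mean velocity when the block runs backwards. *)
have [s [s2 bas]] : exists s : R, s ^+ 2 = 1 /\ (b - a)%:~R = s * k%:R.
  case: bE => ->.
    by exists 1; rewrite expr1n mul1r addrAC subrr add0r.
  by exists (-1); rewrite sqrrN expr1n mulN1r addrAC subrr add0r rmorphN.
have sn : `|s| = 1.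
  by apply/eqP; rewrite -sqrp_eq1// real_normK ?num_real// s2.
exists (U a), ((s / (k%:R * tau)) *: (U b - U a)); split.
- apply: le_trans (disc_pos_lip _ _) _.
  by rewrite ler_wpM2r// mulr_ge0// ltW.
- have E : (s / (k%:R * tau)) *: (U b - U a) - v i =
     (s / (k%:R * tau)) *: (U b - U a - ((b - a)%:~R * tau) *: v a) + (v a - v i).
    have F : (s / (k%:R * tau)) *: (((b - a)%:~R * tau) *: v a) = v a.
      rewrite scalerA bas (_ : _ * _ = s ^+ 2); first by rewrite s2 scale1r.
      by field; rewrite !gt_eqF.
    by rewrite [in RHS]scalerBr F addrA subrK.
  rewrite E; apply: le_trans (ler_normD _ _) _.
  have -> : 6 * C * (k%:R * tau) = 4 * C * (k%:R * tau) + k%:R * (2 * C * tau) by ring.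
  apply: lerD; last first.
    apply: le_trans (disc_vel_lip _ _) _.
    by rewrite ler_wpM2r// !mulr_ge0// ltW.
  rewrite normrZ normrM sn mul1r normfV gtr0_norm// mulrC ler_pdivrMr//.
  apply: le_trans (disc_taylor _ _) _.
  rewrite bas normrM sn mul1r ger0_norm//.
  by rewrite le_eqVlt; apply/orP; left; apply/eqP; ring.
- have -> : dot ((s / (k%:R * tau)) *: (U b - U a)) ((s / (k%:R * tau)) *: (U b - U a)) =
      dot (U b - U a) (U b - U a) / (k%:R * tau) ^+ 2.
    by rewrite dotZl dotZr mulrA -expr2 expr_div_n s2 mul1r mulrC.
  exact: H.
Qed.

(** The bound near [q] still holds on a smaller ball about [U (i + 1)], so it can be tested against
    the gradient there. The factor [tau] converts the second difference quotient into a velocity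
    increment. *)
Lemma disc_clarke_step i q w e D : 
  (forall x t, `|x - q| < e -> 0 < t < e -> V (x + t *: w) - V x <= D * t) ->
  `|U (i + 1) - q| < e ->
  ~ (exists k : int, i + 1 = N%:Z + 2 * N%:Z * k) ->
  - dot (v (i + 1) - v i) w <= D * tau.
Proof.
move=> H iq bad; have [//|/clarke_gradientP yV] := go_clarke gU (i + 1).
have e0 : 0 < e - `|U (i + 1) - q| by rewrite subr_gt0.
have := yV w _ D e0 _; rewrite disc_vel_diff dotNl !dotZl.
set S := dot _ _ => {}yV.
have : - (tau ^- 2 * S) <= D.
  apply: yV => x t xU /andP[t0 te]; apply: H.
    rewrite -(subrK (U (i + 1)) x) -addrA.
    by apply: le_lt_trans (ler_normD _ _) _; rewrite -ltrBrDr.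
  by rewrite t0 (lt_le_trans te)// gerBl.
have -> : - (tau^-1 * S) = - (tau ^- 2 * S) * tau by field; rewrite gt_eqF.
by rewrite ler_pM2r.
Qed.

(* The last summand absorbs the at most one turning point among the m <= N steps. *)
Lemma disc_clarke_sum i (m : nat) q w e D : 
  (forall x t, `|x - q| < e -> 0 < t < e -> V (x + t *: w) - V x <= D * t) ->
  (m <= N)%N -> `|U i - q| + m%:R * (M * tau) < e ->
  - dot (v (i + m%:Z) - v i) w <=
    m%:R * (D * tau) + (n%:R * (2 * C * tau) * `|w| + `|D * tau|).
Proof.
move=> H mN iq.
pose g (l : nat) := - dot (v (i + l%:Z)) w.
have -> : - dot (v (i + m%:Z) - v i) w = g m - g 0%N.
  by rewrite /g addr0 dotDl dotNl opprD.
have gS l : g l.+1 - g l = - dot (v (i + l%:Z + 1) - v (i + l%:Z)) w.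
  rewrite /g dotDl dotNl opprD.
  by rewrite (_ : i + l.+1%:Z = (i + l%:Z) + 1)//; lia.
pose bad (l : nat) := exists k : int, i + l%:Z + 1 = N%:Z + 2 * N%:Z * k.
(* Turning points differ by multiples of [2 * N], and fewer than [N] separate two indices below [m];
   so at most one is bad. *)
have [l0 l0P] : exists l0, forall l, (l < m)%N -> l != l0 -> ~ bad l.
  have [[l0 [l0m l0b]]|nb] := pselect (exists l0, (l0 < m)%N /\ bad l0); last first.
    by exists 0%N => l lm _ lb; apply: nb; exists l.
  exists l0 => l lm ll0 [k kE]; case: l0b => k' kE'.
  have kk : (l%:Z - l0%:Z) = 2 * N%:Z * (k - k') by lia.
  have [E|] := eqVneq k k'; first by rewrite E subrr mulr0 in kk; lia.
  move=> kk'; have : 1 <= `|k - k'| by lia.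
  have : `|l%:Z - l0%:Z| < N%:Z by lia.
  rewrite kk normrM gtr0_norm; last by lia.
  move=> h1 h2; have : 2 * N%:Z * 1 <= 2 * N%:Z * `|k - k'| by rewrite ler_wpM2l.
  by lia.
apply: (@sum_increments_le _ g _ _ m l0).
- by rewrite !mulr_ge0// ltW.
- move=> l lm ll0; rewrite gS; apply: (disc_clarke_step H); last exact: l0P.
  apply: le_lt_trans iq; rewrite -(subrK (U i) (U _)) -addrA.
  apply: le_trans (ler_normD _ _) _; rewrite [leLHS]addrC lerD2l.
  rewrite (_ : i + l%:Z + 1 = i + l.+1%:Z); last by lia.
  apply: le_trans (disc_pos_nat _ _) _; rewrite ler_wpM2r ?ler_nat//.
  by rewrite mulr_ge0// ltW.
- rewrite gS; apply: le_trans (ler_norm _) _; rewrite normrN.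
  apply: le_trans (dot_le_norm _ _) _; rewrite ler_wpM2r// ler_wpM2l//.
  exact: disc_vel_step.
Qed.

End good_orbit.

(** * Passage to the limit *)

Lemma ultra_bounded_cvg (R : realType) n (F : set_system nat)
    (FU : UltraFilter F) (f : nat -> 'rV[R]_n) (B : R) :
  (forall k, `|f k| <= B) -> exists l : 'rV[R]_n, f @ F --> l.
Proof.
move=> fB.
have cB : compact (closed_ball_ Num.norm (0 : 'rV[R]_n) B).
  apply: bounded_closed_compact; last exact: closed_closed_ball_.
  exists B; split; [exact: num_real|move=> x Bx u; rewrite /closed_ball_ /= sub0r normrN => uB].
  exact: le_trans uB (ltW Bx).
have fK : (f @ F) (closed_ball_ Num.norm (0 : 'rV[R]_n) B).
  apply: (@filterS _ F _ setT); last exact: filterT.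
  by move=> k _; rewrite /closed_ball_ /= sub0r normrN.
have [l [_ lc]] := cB (f @ F) (fmap_proper_filter _ _) fK.
exists l => A lA; have [//|FA] := in_ultra_setVsetC (f @^-1` A) FU.
by have [x [nAx Ax]] := lc (~` A) A FA lA.
Qed.

Lemma cvg_le_trans (R : realType) (F : set_system nat) (FF : ProperFilter F)
    (f g : nat -> R) (a b : R) :
  f @ F --> a -> g @ F --> b -> (\forall k \near F, f k <= g k) -> a <= b.
Proof.
move=> fa gb fg; rewrite -(cvg_lim (@Rhausdorff R) fa) -(cvg_lim (@Rhausdorff R) gb).
by apply: ler_lim => //; apply: cvgP; [exact: fa|exact: gb].
Qed.

Lemma cvg_close (R : realType) (X : normedModType R) (F : set_system nat)
    (FF : ProperFilter F) (f g : nat -> X) (r : nat -> R) (l : X) :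
  f @ F --> l -> r @ F --> (0 : R) -> (\forall k \near F, `|g k - f k| <= r k) ->
  g @ F --> l.
Proof.
move=> fl r0 gf.
have H : (fun k => g k - f k) @ F --> (0 : X).
  apply/cvgr0Pnorm_lt => e e0.
  have /cvgr0Pnorm_lt/(_ e e0) rs := r0.
  apply: filterS2 gf rs => k gk rk; apply: le_lt_trans gk _.
  exact: le_lt_trans (ler_norm _) rk.
rewrite -[l]addr0 (_ : g = fun k => f k + (g k - f k)); first exact: cvgD.
by apply/funext => k; rewrite addrC subrK.
Qed.

(** Clearing denominators gives [(a - b) * k <= b] and [(b - a) * k <= b] for all large [k], so
    neither difference is positive. *)
Lemma eq_of_scaled_bounds (R : realType) (a b : R) :
  (forall k : nat, (1 < k)%N -> a * (k%:R / (k%:R + 1)) <= b /\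
     b <= a * (k%:R / (k%:R - 1))) -> a = b.
Proof.
move=> H.
have H' (k : nat) : (1 < k)%N -> (a - b) * k%:R <= b /\ (b - a) * k%:R <= b.
  move=> k1; have [h1 h2] := H k k1.
  have k1R : 1 < k%:R :> R by rewrite ltr1n.
  have kp : 0 < k%:R + 1 :> R by rewrite addr_gt0// (lt_trans ltr01).
  have km : 0 < k%:R - 1 :> R by rewrite subr_gt0.
  rewrite mulrA ler_pdivrMr// in h1; rewrite mulrA ler_pdivlMr// in h2.
  by split; lra.
have arch (x : R) : (forall k : nat, (1 < k)%N -> x * k%:R <= b) -> x <= 0.
  move=> xb; rewrite leNgt; apply/negP => x0.
  pose k := (Num.bound (`|b| / x)).+2.
  have := xb k isT; rewrite leNgt => /negP; apply.
  rewrite mulrC -ltr_pdivrMr//; apply: (@le_lt_trans _ _ (`|b| / x)).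
    by rewrite ler_pM2r ?invr_gt0// ler_norm.
  apply: lt_le_trans (archi_boundP _) _; first by rewrite divr_ge0// ltW.
  by rewrite ler_nat /k; lia.
have h1 := arch (a - b) (fun k k1 => (H' k k1).1).
have h2 := arch (b - a) (fun k k1 => (H' k k1).2).
lra.
Qed.

Section limit_orbit.
Variables (R : realType) (n : nat) (V : 'rV[R]_n -> R).
Variables (h B M C c L d : R) (tau : nat -> R) (N : nat -> nat).
Variable (U : nat -> int -> 'rV[R]_n).
Hypotheses (cV : continuous V) (tau0 : forall k, 0 < tau k) (M0 : 0 < M) (C0 : 0 < C)
  (c0 : 0 < c) (d0 : 0 < d).
Hypothesis gU : forall k, good_orbit V h B M C c L d (tau k) (N k) (U k).
Hypothesis tauoo : tau @ \oo --> (0 : R).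

(** The orbits are interpolated as step functions of time. Rounding a time to the grid is an error
    of at most one step, which accounts for the terms [+ tau k] in the estimates below. *)
Let ix k (t : R) : int := Num.floor (t / tau k).
Let Qk k t := U k (ix k t).
Let Pk k t := disc_vel (tau k) (U k) (ix k t).

Lemma floor_step k t s : `|(ix k t - ix k s)%:~R * tau k - (t - s)| <= tau k.
Proof.
have E : (ix k t - ix k s)%:~R * tau k - (t - s) =
    ((ix k t - ix k s)%:~R - (t / tau k - s / tau k)) * tau k.
  by field; rewrite gt_eqF.
rewrite E normrM (gtr0_norm (tau0 k)) -[leRHS]mul1r ler_pM2r//.
have /andP[t1 t2] := floor_itv (t / tau k).
have /andP[s1 s2] := floor_itv (s / tau k).
rewrite -/(ix k t) in t1 t2; rewrite -/(ix k s) in s1 s2.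
rewrite rmorphB /=; rewrite rmorphD /= in t2; rewrite rmorphD /= in s2.
by rewrite ler_norml; apply/andP; split; lra.
Qed.

Lemma floor_step_le k t s : `|(ix k t - ix k s)%:~R| * tau k <= `|t - s| + tau k.
Proof.
have := floor_step k t s; set z := _%:~R => H.
have -> : `|z| * tau k = `|z * tau k - (t - s) + (t - s)|.
  by rewrite subrK normrM (gtr0_norm (tau0 k)).
by rewrite [leRHS]addrC; apply: le_trans (ler_normD _ _) (lerD H _).
Qed.

Lemma Qk_lip k t s : `|Qk k t - Qk k s| <= M * (`|t - s| + tau k).
Proof.
apply: le_trans (disc_pos_lip (tau0 k) M0 C0 (gU k) _ _) _.
by rewrite mulrCA ler_pM2l// floor_step_le.
Qed.

Lemma Pk_lip k t s : `|Pk k t - Pk k s| <= 2 * C * (`|t - s| + tau k).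
Proof.
apply: le_trans (disc_vel_lip (tau0 k) M0 C0 (gU k) _ _) _.
by rewrite mulrCA ler_pM2l ?mulr_gt0// floor_step_le.
Qed.

Lemma Qk_taylor k t s :
  `|Qk k t - Qk k s - (t - s) *: Pk k s| <= 4 * C * (`|t - s| + tau k) ^+ 2 + tau k * M.
Proof.
have -> : Qk k t - Qk k s - (t - s) *: Pk k s =
    (Qk k t - Qk k s - ((ix k t - ix k s)%:~R * tau k) *: Pk k s) +
    ((ix k t - ix k s)%:~R * tau k - (t - s)) *: Pk k s.
  by rewrite [in RHS]scalerBl [in RHS]addrA subrK.
apply: le_trans (ler_normD _ _) _; apply: lerD.
  apply: le_trans (disc_taylor (tau0 k) M0 C0 (gU k) _ _) _.
  rewrite ler_pM2l ?mulr_gt0// ler_sqr ?nnegrE ?addr_ge0 ?mulr_ge0 ?(ltW (tau0 k))//.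
  exact: floor_step_le.
rewrite normrZ ler_pM//; first exact: floor_step.
exact: (disc_vel_le (tau0 k) (gU k)).
Qed.

(** The last clause is the inclusion in integrated form. It speaks of increments of [P] only, so it
    holds at every [t], before anything is known about derivatives of [P]. *)
Lemma limit_orbit : exists (Q P : R -> 'rV[R]_n) (T : R),
  [/\ 0 < T, Q 0 = 0 & forall t, Q (t + T) = Q t] /\
  [/\ forall t s, `|P t - P s| <= 2 * C * `|t - s|,
      forall t s, `|Q t - Q s - (t - s) *: P s| <= 4 * C * `|t - s| ^+ 2,
      forall t, 2^-1 * dot (P t) (P t) + V (Q t) = h &
      forall t w (e D : R), 0 < e ->
        (forall x s, `|x - Q t| < e -> 0 < s < e -> V (x + s *: w) - V x <= D * s) ->
        exists2 r : R, 0 < r & forall s, 0 < s < r ->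
          - dot (P (t + s) - P t) w <= s * D].
Proof.
(* Along an ultrafilter all pointwise limits exist at once, without extracting
   subsequences; the limits inherit the bounds, so pointwise convergence suffices. *)
have [F [FU Foo]] := ultraFilterLemma (eventually_filter : ProperFilter \oo).
have tauF : tau @ F --> (0 : R).
  by apply: cvg_trans tauoo => A; exact: Foo.
have Qc t : exists l : 'rV[R]_n, (fun k => Qk k t) @ F --> l.
  by apply: (@ultra_bounded_cvg _ _ _ _ _ B) => k; exact: (go_bound (gU k)).
have Pc t : exists l : 'rV[R]_n, (fun k => Pk k t) @ F --> l.
  by apply: (@ultra_bounded_cvg _ _ _ _ _ M) => k; exact: (disc_vel_le (tau0 k) (gU k)).
have [Q QP] := choice Qc.
have [P PP] := choice Pc.
have [Th ThP] : exists l : R, (fun k => (N k)%:R * tau k) @ F --> l.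
  have [l lP] : exists l : 'rV[R]_1, (fun k => const_mx ((N k)%:R * tau k) : 'rV[R]_1) @ F --> l.
    apply: (@ultra_bounded_cvg _ _ _ _ _ C) => k.
    have /andP[k1 k2] := go_time (gU k).
    apply: norm_le_coord => [|i]; first exact: ltW.
    by rewrite mxE ger0_norm// (le_trans (ltW c0)).
  exists (l ord0 ord0).
  have := @cvg_comp _ _ _ _ (fun u : 'rV[R]_1 => u ord0 ord0) F (nbhs l) _ lP
    (@coord_continuous_rV R 1 ord0 l).
  by apply: cvg_trans; apply: near_eq_cvg; apply: nearW => k /=; rewrite mxE.
have cc : c <= Th.
  apply: (@cvg_le_trans _ F _ (fun=> c) _ _ _ (cvg_cst c) ThP).
  by apply: nearW => k; have /andP[] := go_time (gU k).
have tlin (a b : R) : (fun k => a * (b + tau k)) @ F --> a * b.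
  rewrite -[X in _ --> a * X]addr0; apply: cvgM; first exact: cvg_cst.
  by apply: cvgD => //; exact: cvg_cst.
have small (r : R) : 0 < r -> \forall k \near F, tau k < r.
  move=> r0; have /cvgr0Pnorm_lt/(_ r r0) := tauF.
  by apply: filterS => k; apply: le_lt_trans; exact: ler_norm.
exists Q, P, (4 * Th); split; split.
- by rewrite mulr_gt0// (lt_le_trans c0).
- have E : (fun k => Qk k 0) = fun=> 0.
    by apply/funext => k; rewrite /Qk /ix mul0r floor0 (go_start (gU k)).
  have Q0 : (fun k => Qk k 0) @ F --> Q 0 := QP 0.
  rewrite E in Q0.
  exact: (cvg_unique (@norm_hausdorff _ _) Q0 (cvg_cst (0 : 'rV[R]_n))).
- move=> t; apply/eqP; rewrite -subr_eq0 -normr_le0.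
  apply: (@cvg_le_trans _ F _ (fun k => `|Qk k (t + 4 * Th) - Qk k t|)
    (fun k => M * (`|4 * Th - 4 * ((N k)%:R * tau k)| + tau k))).
  + by apply: cvg_norm; apply: cvgB.
  + rewrite -(mulr0 M) -[X in _ --> M * X]addr0; apply: cvgM; first exact: cvg_cst.
    apply: cvgD => //.
    have H1 : (fun k => 4 * Th - 4 * ((N k)%:R * tau k)) @ F --> (0 : R).
      rewrite -(subrr (4 * Th)); apply: cvgB; first exact: cvg_cst.
      by apply: cvgM => //; exact: cvg_cst.
    by have := cvg_norm H1; rewrite normr0; apply.
  + apply: nearW => k.
    (* The discrete period is a whole number of steps, so rounding commutes with this shift; the
       periods then converge to [4 * Th]. *)
    have -> : Qk k t = Qk k (t + 4 * ((N k)%:R * tau k)).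
      rewrite /Qk /ix mulrDl (_ : 4 * ((N k)%:R * tau k) / tau k = (4 * N k)%N%:~R); last first.
        by rewrite -pmulrn natrM; field; rewrite gt_eqF.
      by rewrite floorDrz ?intr_int// intrKfloor (go_periodic (gU k)).
    apply: le_trans (Qk_lip _ _ _) _.
    by rewrite opprD addrACA subrr add0r.
- move=> t s.
  apply: (@cvg_le_trans _ F _ (fun k => `|Pk k t - Pk k s|) _ _ _ _ (tlin _ _)).
    by apply: cvg_norm; apply: cvgB.
  by apply: nearW => k; exact: Pk_lip.
- move=> t s.
  apply: (@cvg_le_trans _ F _ (fun k => `|Qk k t - Qk k s - (t - s) *: Pk k s|)
     (fun k => 4 * C * (`|t - s| + tau k) ^+ 2 + tau k * M)).
  + apply: cvg_norm; apply: cvgB; first exact: cvgB.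
    by apply: cvgZr.
  + rewrite -[X in _ --> X]addr0 -(mul0r M); apply: cvgD; last first.
      by apply: cvgM => //; exact: cvg_cst.
    apply: cvgM; first exact: cvg_cst.
    rewrite !expr2; have H : (fun k => `|t - s| + tau k) @ F --> `|t - s|.
      by rewrite -[X in _ --> X]addr0; apply: cvgD => //; exact: cvg_cst.
    exact: cvgM.
  + by apply: nearW => k; exact: Qk_taylor.
- move=> t; have [] : 2^-1 * dot (P t) (P t) = h - V (Q t); last by move=> ->; rewrite subrK.
  (* Two limits in this order: [tau] tends to 0 with blocks of [K] steps, [K] fixed, and only then
     does [K] grow. *)
  apply: eq_of_scaled_bounds => K K1.
  have K0 : 0 < K%:R :> R by rewrite ltr0n ltnW.
  have nearK : \forall k \near F, (K <= N k)%N /\ K%:R * (M * tau k) < d.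
    have r1 : 0 < c / K%:R by rewrite divr_gt0.
    have r2 : 0 < d / (K%:R * M) by rewrite divr_gt0// mulr_gt0.
    apply: filterS2 (small _ r1) (small _ r2) => k.
    rewrite ltr_pdivlMr// ltr_pdivlMr ?mulr_gt0// => h1 h2; split.
      have /andP[h3 _] := go_time (gU k).
      rewrite -(ler_nat R) -(ler_pM2r (tau0 k)) mulrC.
      by apply: ltW; apply: lt_le_trans h1 h3.
    by rewrite mulrA mulrC.
  pose E k := tau k ^+ 2 + (2 * K%:R + 1) * (L * (K%:R * (M * tau k))).
  (* The choice must be made for every [k]; the default [(0, 0)] serves those [k] for which a block
     of [K] steps is too long, a set negligible for [F] by [nearK]. *)
  have xwE k : exists xw : 'rV[R]_n * 'rV[R]_n,
      (K <= N k)%N /\ K%:R * (M * tau k) < d ->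
      [/\ `|xw.1 - Qk k t| <= K%:R * (M * tau k),
    `|xw.2 - Pk k t| <= 6 * C * (K%:R * tau k) &
    dot xw.2 xw.2 / 2 * (K%:R / (K%:R + 1)) <= h - V xw.1 + E k /\
    h - V xw.1 <= dot xw.2 xw.2 / 2 * (K%:R / (K%:R - 1)) + E k].
    have [[h1 h2]|nh] := pselect ((K <= N k)%N /\ K%:R * (M * tau k) < d); last by exists (0, 0).
    have [x [w H]] := disc_energy (tau0 k) M0 C0 (gU k) (ix k t) K1 h1 h2.
    by exists (x, w) => _; exact: H.
  have [xw xwP] := choice xwE.
  have lin0 (a : R) : (fun k => a * tau k) @ F --> (0 : R).
    by rewrite -(mulr0 a); apply: cvgM => //; exact: cvg_cst.
  have xc : (fun k => (xw k).1) @ F --> Q t.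
    apply: (@cvg_close _ _ F _ _ _ (fun k => (K%:R * M) * tau k) _ (QP t) (lin0 _)).
    by apply: filterS nearK => k /xwP[]; rewrite mulrA.
  have wc : (fun k => (xw k).2) @ F --> P t.
    apply: (@cvg_close _ _ F _ _ _ (fun k => (6 * C * K%:R) * tau k) _ (PP t) (lin0 _)).
    by apply: filterS nearK => k /xwP[_ + _]; rewrite !mulrA.
  have dc : (fun k => dot (xw k).2 (xw k).2) @ F --> dot (P t) (P t) by exact: cvg_dot.
  have Vc : (fun k => V (xw k).1) @ F --> V (Q t).
    by apply: (cvg_comp (fun k => (xw k).1) V xc); exact: cV.
  have Ec : E @ F --> (0 : R).
    rewrite -[X in _ --> X]addr0; apply: cvgD.
      rewrite -(mulr0 (0 : R)) (_ : (fun k => tau k ^+ 2) = fun k => tau k * tau k).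
        exact: cvgM.
      by apply/funext => k; rewrite expr2.
    rewrite (_ : (fun k => _) = fun k => ((2 * K%:R + 1) * L * K%:R * M) * tau k) //.
    by apply/funext => k; rewrite !mulrA.
  have hV : (fun k => h - V (xw k).1) @ F --> h - V (Q t).
    by apply: cvgB => //; exact: cvg_cst.
  have sc (a : R) : (fun k => dot (xw k).2 (xw k).2 / 2 * a) @ F --> 2^-1 * dot (P t) (P t) * a.
    rewrite [2^-1 * _]mulrC; apply: cvgM; last exact: cvg_cst.
    by apply: cvgM => //; exact: cvg_cst.
  split.
    apply: (@cvg_le_trans _ F _ _ (fun k => h - V (xw k).1 + E k) _ _ (sc _)).
      by rewrite -[X in _ --> X]addr0; exact: cvgD.
    by apply: filterS nearK => k /xwP[_ _ []].
  apply: (@cvg_le_trans _ F _ _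
    (fun k => dot (xw k).2 (xw k).2 / 2 * (K%:R / (K%:R - 1)) + E k) _ _ hV).
    by rewrite -[X in _ --> X]addr0; exact: cvgD.
  by apply: filterS nearK => k /xwP[_ _ []].
- move=> t w e D e0 H.
  have r1 : 0 < e / (4 * M) by rewrite divr_gt0// mulr_gt0.
  have r2 : 0 < c / 2 by rewrite divr_gt0.
  (* The drift [M * s], the rounding [M * tau k] and the distance of [Qk k t] to [Q t] are each
     below [e / 4]. The bound [c / 2] on [s] and on [tau k] keeps the number of steps at most [N k],
     so that at most one turning point is met. *)
  exists (Num.min (e / (4 * M)) (c / 2)); first by rewrite lt_min r1.
  move=> s; rewrite lt_min => /andP[s0 /andP[s1 s2]].
  pose D1 k := (n%:R * (2 * C * tau k) * `|w| + `|D * tau k|).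
  apply: (@cvg_le_trans _ F _ (fun k => - dot (Pk k (t + s) - Pk k t) w)
    (fun k => ((ix k (t + s) - ix k t)%:~R * tau k) * D + D1 k)).
  + by apply: cvgN; apply: cvg_dot; [apply: cvgB|exact: cvg_cst].
  + rewrite -[X in _ --> X]addr0; apply: cvgD.
      apply: cvgM; last exact: cvg_cst.
      apply: (@cvg_close _ _ F _ (fun=> s) _ tau _ (cvg_cst _) tauF).
      apply: nearW => k; have := floor_step k (t + s) t.
      by rewrite (_ : t + s - t = s)// addrAC subrr add0r.
    rewrite -[X in _ --> X]addr0; apply: cvgD.
      rewrite (_ : (fun k => _) = fun k => (n%:R * (2 * C) * `|w|) * tau k); last first.
        by apply/funext => k; ring.
      by rewrite -(mulr0 (n%:R * (2 * C) * `|w|)); apply: cvgM => //; exact: cvg_cst.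
    have H1 : (fun k => D * tau k) @ F --> (0 : R).
      by rewrite -(mulr0 D); apply: cvgM => //; exact: cvg_cst.
    by have := cvg_norm H1; rewrite normr0; apply.
  + have /cvgrPdist_lt/(_ (e / 4)) Qn := QP t.
    have {}Qn := Qn ltac:(by rewrite divr_gt0).
    apply: filterS3 Qn (small _ r1) (small _ r2) => k Qn t1 t2.
    have ixle : ix k t <= ix k (t + s).
      by apply: le_floor; rewrite ler_pM2r ?invr_gt0// lerDl ltW.
    pose m := `|(ix k (t + s) - ix k t)%R|%N.
    have mE : ix k (t + s) = ix k t + m%:Z by rewrite /m; clear -ixle; lia.
    have mR : (ix k (t + s) - ix k t)%:~R = m%:R :> R.
      by rewrite mE addrAC subrr add0r.
    have ms : m%:R * tau k <= s + tau k.
      have := floor_step_le k (t + s) t; rewrite mR ger0_norm//.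
      by rewrite (_ : t + s - t = s) ?gtr0_norm// addrAC subrr add0r.
    have mN : (m <= N k)%N.
      have /andP[h3 _] := go_time (gU k).
      rewrite -(ler_nat R) -(ler_pM2r (tau0 k)).
      apply: le_trans ms (le_trans _ h3); lra.
    have := disc_clarke_sum (tau0 k) M0 C0 (gU k) (i := ix k t) (m := m) H mN.
    rewrite mR -mE => HH; have {}HH := HH _.
    rewrite -mulrA (mulrC (tau k)); apply: HH.
    rewrite mulrCA distrC -/(Qk k t).
    have : M * (m%:R * tau k) <= M * (s + tau k) by rewrite ler_pM2l.
    rewrite ltr_pdivlMr ?mulr_gt0// in s1; rewrite ltr_pdivlMr ?mulr_gt0// in t1.
    by move: Qn; lra.
Qed.

End limit_orbit.

(** * Almost everywhere derivability of Lipschitz functions *)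

Lemma lebesgue_stieltjes_measure_itv_oc (R : realType) (g : cumulative R R) (a b : R) :
  a <= b -> lebesgue_stieltjes_measure g `]a, b]%classic = (g b - g a)%:E.
Proof.
move=> ab; rewrite /lebesgue_stieltjes_measure /measure_extension.
rewrite measurable_mu_extE/=; last exact: is_ocitv.
by rewrite wlength_itv_bnd.
Qed.

Lemma lipschitz_continuous_real (R : realType) (g : R -> R) (K : R) :
  (forall x y, `|g x - g y| <= K * `|x - y|) -> continuous g.
Proof.
move=> gK x; apply/cvgrPdist_lt => e e0.
have K1 : 0 < `|K| + 1 by rewrite ltr_wpDl.
have eK : 0 < e / (`|K| + 1) by rewrite divr_gt0.
apply: filterS (nbhsx_ballx x _ eK) => y; rewrite -ball_normE /= => xy.
apply: le_lt_trans (gK x y) _.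
apply: (@le_lt_trans _ _ ((`|K| + 1) * `|x - y|)).
  by rewrite ler_wpM2r// (le_trans (ler_norm K))// lerDl.
by rewrite mulrC -ltr_pdivlMr.
Qed.

Lemma continuous_right_continuous (R : realType) (g : R -> R) :
  continuous g -> right_continuous g.
Proof. by move=> cg x; apply: cvg_at_right_filter; exact: cg. Qed.

Section ae_derivable.
Variable R : realType.
Let mu := @lebesgue_measure R.

(* K x - g x is again nondecreasing, so that K times the Lebesgue measure is the
   sum of two Stieltjes measures, one of which is that of g. *)
Lemma cdf_lipschitz_dominates (g : cumulative R R) (K : R) : 0 < K ->
  (forall x y, `|g x - g y| <= K * `|x - y|) ->
  lebesgue_stieltjes_measure g `<< mu.
Proof.
move=> K0 gK.
have gnd : nondecreasing g by exact: cumulative_is_nondecreasing.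
pose k x := K * x - g x.
have kK x y : `|k x - k y| <= (K + K) * `|x - y|.
  have -> : k x - k y = K * (x - y) - (g x - g y) by rewrite /k; ring.
  apply: le_trans (ler_normB _ _) _; rewrite mulrDl lerD//.
  by rewrite normrM gtr0_norm.
have knd : nondecreasing k.
  move=> x y xy; rewrite /k; have := gK y x.
  rewrite ger0_norm ?subr_ge0 ?gnd// ger0_norm ?subr_ge0//.
  lra.
have krc := continuous_right_continuous (lipschitz_continuous_real kK).
pose k' : cumulative R R := HB.pack k (isCumulative.Build R _ R k knd krc).
have K'0 : 0 <= K^-1 by rewrite invr_ge0 ltW.
pose nu := mscale (NngNum K'0)
  (measure_add (lebesgue_stieltjes_measure g) (lebesgue_stieltjes_measure k')).
have nuE A : nu A = (K^-1%:E * (lebesgue_stieltjes_measure g A +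
    lebesgue_stieltjes_measure k' A))%E.
  by rewrite -measure_addE.
have muE A : measurable A -> mu A = nu A.
  apply: lebesgue_measure_unique => X [[a b] _ <-] /=.
  apply: (etrans _ (esym (nuE _))).
  have oc (g1 : cumulative R R) := @lebesgue_stieltjes_measure_itv_oc R g1.
  wlog ab : b / a <= b.
    move=> H; have [|/ltW ba] := leP a b; first exact: H.
    have -> : `]a, b]%classic = `]a, a]%classic :> set R.
      by rewrite !set_itv_ge// bnd_simp -leNgt.
    exact: H.
  apply: (etrans (oc idfun a b ab)); apply: esym.
  apply: (etrans (congr2 (fun u v => (K^-1%:E * (u + v))%E) (oc g a b ab) (oc k' a b ab))).
  rewrite -EFinD -EFinM; congr EFin; rewrite /= /k.
  by field; rewrite gt_eqF.
apply/null_content_dominatesP => A mA muA0.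
have /eqP := etrans (esym (nuE A)) (etrans (esym (muE A mA)) muA0).
rewrite mule_eq0 => /orP[|].
  by rewrite eqe invr_eq0 gt_eqF.
by rewrite padde_eq0 ?measure_ge0// => /andP[/eqP].
Qed.

(** By domination the Stieltjes measure of [g] has an integrable density, so on each half-line from
    [- m] the function [g] is, up to a constant, an indefinite integral; Lebesgue differentiation
    applies, and countably many [m] exhaust the line. *)
Lemma cdf_lipschitz_ae_derivable (g : cumulativeBounded (0 : R) (1 : R)) (K : R) :
  0 < K -> (forall x y, `|g x - g y| <= K * `|x - y|) ->
  {ae mu, forall x, derivable g x 1}.
Proof.
move=> K0 gK.
have [phi [phi0 phifin phiint phiE]] :=
  radon_nikodym_sigma_finite (cdf_lipschitz_dominates K0 gK).
pose f x := fine (phi x).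
have fE : EFin \o f = phi by apply/funext => x; rewrite /f /= fineK.
have fint : mu.-integrable setT (EFin \o f) by rewrite fE.
have floc : locally_integrable [set: R] f.
  exact: (open_integrable_locally openT fint).
have H (m : nat) : {ae mu, forall x, - m%:R < x -> derivable g x 1}.
  have fintI y : mu.-integrable [set` Interval (BRight (- m%:R)) (BRight y)] (EFin \o f).
    by apply: integrableS fint => //; exact: measurable_itv.
  have := FTC1 fintI floc.
  apply: filterS; first exact: (ae_filter_ringOfSetsType mu).
  move=> x Hx mx.
  have [dx _] := Hx mx.
  pose F y := (\int[mu]_(t in [set` Interval (BRight (- m%:R)) (BRight y)]) f t)%R.
  have Fg y : - m%:R < y -> F y = g y - g (- m%:R).
    move=> my; rewrite /F /Rintegral.
    rewrite (eq_integral phi); last by move=> z _; rewrite -fE.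
    rewrite -phiE; last exact: measurable_itv.
    exact: (congr1 fine (lebesgue_stieltjes_measure_itv_oc g (ltW my))).
  have dF : derivable (F + cst (g (- m%:R))) x 1.
    by apply: derivableD; [exact: dx|exact: derivable_cst].
  apply: near_eq_derivable dF.
  have xm : 0 < x + m%:R by rewrite -[m%:R]opprK subr_gt0.
  apply: filterS (nbhsx_ballx x _ xm) => y; rewrite -ball_normE /= => xy.
  rewrite /cst fctE Fg ?subrK//.
  by have := ler_norm (x - y); move: xy; lra.
have HH : {ae mu, forall x, forall m : nat, - m%:R < x -> derivable g x 1}.
  exact: ae_foralln H.
move: HH.
apply: filterS; first exact: (ae_filter_ringOfSetsType mu).
move=> x Hx.
apply: (Hx (Num.bound `|x|)); rewrite ltrNl.
by apply: le_lt_trans (ler_norm _) _; rewrite normrN; exact: archi_boundP.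
Qed.

(* f x + (L + 1) x is increasing; clamped to [- b, b] and normalised it becomes a
   Lipschitz distribution function. *)
Lemma lipschitz_ae_derivable (f : R -> R) (L : R) : 0 <= L ->
  (forall x y, `|f x - f y| <= L * `|x - y|) -> {ae mu, forall x, derivable f x 1}.
Proof.
move=> L0 fL.
(* Slope [L + 1] rather than [L] makes [F] increase at rate at least 1, so the normalising factor
   [s] below is positive. *)
pose F x := f x + (L + 1) * x.
have Fnd x y : x <= y -> y - x <= F y - F x.
  move=> xy; have yx : 0 <= y - x by rewrite subr_ge0.
  have := fL y x; rewrite (ger0_norm yx) ler_norml /F.
  by move=> /andP[h1 h2]; lra.
have FL x y : `|F x - F y| <= (2 * L + 1) * `|x - y|.
  have -> : F x - F y = (f x - f y) + (L + 1) * (x - y) by rewrite /F; ring.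
  apply: le_trans (ler_normD _ _) _; rewrite normrM (ger0_norm (_ : 0 <= L + 1)) ?addr_ge0//.
  by have := fL x y; lra.
suff H (m : nat) : {ae mu, forall x, - m.+1%:R < x < m.+1%:R -> derivable f x 1}.
  have HH : {ae mu, forall x, forall m : nat, - m.+1%:R < x < m.+1%:R -> derivable f x 1}.
    exact: ae_foralln H.
  move: HH; apply: filterS; first exact: (ae_filter_ringOfSetsType mu).
  move=> x Hx; apply: (Hx (Num.bound `|x|)).
  have : `|x| < (Num.bound `|x|).+1%:R.
    by apply: lt_trans (archi_boundP _) _ => //; rewrite ltr_nat.
  by rewrite ltr_norml.
set b : R := m.+1%:R; have b0 : 0 < b by rewrite ltr0n.
pose c x := Num.max (- b) (Num.min b x).
have cE x : (x <= - b /\ c x = - b) \/ (- b <= x <= b /\ c x = x) \/ (b <= x /\ c x = b).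
  rewrite /c; case: (leP b x) => bx; first by right; right; rewrite max_r// lerNl; lra.
  case: (leP (- b) x) => xb; [right; left|left]; split=> //=; exact: ltW.
have cL x y : `|c x - c y| <= `|x - y|.
  by have [[? ->]|[[/andP[? ?] ->]|[? ->]]] := cE x;
     have [[? ->]|[[/andP[? ?] ->]|[? ->]]] := cE y;
     rewrite ler_norml; apply/andP; split; case: (ger0P (x - y)) => ?; lra.
have cnd x y : x <= y -> c x <= c y.
  move=> xy.
  by have [[? ->]|[[/andP[? ?] ->]|[? ->]]] := cE x;
     have [[? ->]|[[/andP[? ?] ->]|[? ->]]] := cE y; lra.
pose s := F b - F (- b).
have s0 : 0 < s.
  by apply: lt_le_trans (Fnd (- b) b _); rewrite ?subr_gt0; lra.
pose g x := (F (c x) - F (- b)) / s.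
have gnd : nondecreasing g.
  move=> x y xy; rewrite /g ler_pM2r ?invr_gt0// lerD2r -subr_ge0.
  by apply: le_trans (Fnd _ _ (cnd _ _ xy)); rewrite subr_ge0 cnd.
pose K := (2 * L + 1) / s.
have K0 : 0 < K by rewrite divr_gt0// ltr_wpDl// mulr_ge0.
have gL x y : `|g x - g y| <= K * `|x - y|.
  have -> : g x - g y = (F (c x) - F (c y)) / s by rewrite /g; ring.
  rewrite normrM normfV (gtr0_norm s0) /K mulrAC ler_pM2r ?invr_gt0//.
  apply: le_trans (FL _ _) _; rewrite ler_wpM2l// addr_ge0// mulr_ge0//.
have grc := continuous_right_continuous (lipschitz_continuous_real gL).
have gNy : g @ -oo --> (0 : R).
  apply: cvg_near_cst; near=> x.
  have xb : x <= - b by near: x; apply: nbhs_ninfty_le; exact: num_real.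
  have cb : c x = - b by have [[? E]|[[/andP[? ?] E]|[? E]]] := cE x; rewrite E; lra.
  by rewrite /g cb subrr mul0r.
have gy : g @ +oo --> (1 : R).
  apply: cvg_near_cst; near=> x.
  have xb : b <= x by near: x; apply: nbhs_pinfty_ge; exact: num_real.
  have cb : c x = b by have [[? E]|[[/andP[? ?] E]|[? E]]] := cE x; rewrite E; lra.
  by rewrite /g cb -/s divff// gt_eqF.
pose g' : cumulativeBounded (0 : R) (1 : R) :=
  HB.pack g (isCumulative.Build R _ R g gnd grc) (isCumulativeBounded.Build R 0 1 g gNy gy).
have := @cdf_lipschitz_ae_derivable g' K K0 gL.
apply: filterS; first exact: (ae_filter_ringOfSetsType mu).
move=> x dg /andP[x1 x2].
(* Inside ]- b, b[ the clamp is the identity, and this expression is [f]. *)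
have dG : derivable (fun y => s * g y + F (- b) - (L + 1) * y) x 1.
  have d1 : derivable (fun y => s * g y) x 1.
    by apply: derivableM; [exact: derivable_cst|exact: dg].
  have d2 : derivable (fun y : R => (L + 1) * y) x 1.
    by apply: derivableM; [exact: derivable_cst|exact: derivable_id].
  have d3 : derivable (fun=> F (- b)) x 1 by exact: derivable_cst.
  exact: (derivableB (derivableD d1 d3) d2).
apply: near_eq_derivable dG.
have e0 : 0 < Num.min (x + b) (b - x) by rewrite lt_min; apply/andP; split; lra.
apply: filterS (nbhsx_ballx x _ e0) => y; rewrite -ball_normE /= lt_min => /andP[y1 y2].
rewrite ltr_norml in y1; rewrite ltr_norml in y2.
have cy : c y = y by have [[? E]|[[/andP[? ?] E]|[? E]]] := cE y; rewrite E; lra.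
by rewrite /g cy /F; field; rewrite gt_eqF.
Unshelve. all: by end_near. Qed.

End ae_derivable.

(** * The periodic solution *)

Section taylor.
Variables (R : realType) (n : nat) (Q P : R -> 'rV[R]_n) (K : R).
Hypothesis QP : forall t s, `|Q t - Q s - (t - s) *: P s| <= K * `|t - s| ^+ 2.

Lemma taylor_cvg t : (fun h : R => h^-1 *: (Q (h + t) - Q t)) @ 0^' --> P t.
Proof.
apply/cvgrPdist_lt => e e0.
have K1 : 0 < `|K| + 1 by rewrite ltr_wpDl.
have eK : 0 < e / (`|K| + 1) by rewrite divr_gt0.
near=> h.
have h0 : h != 0 by near: h; exact: nbhs_dnbhs_neq.
have hs : `|h| < e / (`|K| + 1) by near: h; exact: dnbhs0_lt.
have hp : 0 < `|h| by rewrite normr_gt0.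
have -> : P t - h^-1 *: (Q (h + t) - Q t) = - (h^-1 *: (Q (h + t) - Q t - (h + t - t) *: P t)).
  by rewrite addrK [in RHS]scalerBr scalerA mulVf// scale1r opprB.
rewrite normrN normrZ normfV mulrC ltr_pdivrMr//.
apply: le_lt_trans (QP _ _) _; rewrite addrK expr2 mulrA ltr_pM2r//.
apply: (@le_lt_trans _ _ (`|h| * (`|K| + 1))); last by rewrite -ltr_pdivlMr.
by rewrite mulrC ler_pM2l// (le_trans (ler_norm K))// lerDl.
Unshelve. all: by end_near. Qed.

Lemma taylor_derivable t : derivable Q t 1.
Proof.
apply/cvg_ex; exists (P t).
rewrite (_ : (fun h => _) = (fun h : R => h^-1 *: (Q (h + t) - Q t))).
  exact: taylor_cvg.
by apply/funext => h /=; rewrite [h *: 1]mulr1.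
Qed.

Lemma taylor_derive1 : derive1 Q = P.
Proof.
by apply/funext => t; rewrite /derive1; apply: cvg_lim; [exact: norm_hausdorff|exact: taylor_cvg].
Qed.
End taylor.

Section lipschitz_curve.
Variables (R : realType) (n : nat) (P : R -> 'rV[R]_n) (K : R).
Hypotheses (K0 : 0 <= K) (PK : forall t s, `|P t - P s| <= K * `|t - s|).

Lemma lipschitz_curve_continuous : continuous P.
Proof.
move=> x; apply/cvgrPdist_lt => e e0.
have K1 : 0 < K + 1 by rewrite ltr_wpDl.
have eK : 0 < e / (K + 1) by rewrite divr_gt0.
apply: filterS (nbhsx_ballx x _ eK) => y; rewrite -ball_normE /= => xy.
apply: le_lt_trans (PK x y) _.
apply: (@le_lt_trans _ _ ((K + 1) * `|x - y|)); first by rewrite ler_wpM2r// lerDl.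
by rewrite mulrC -ltr_pdivlMr.
Qed.

Lemma lipschitz_curve_locally_ac : locally_absolutely_continuous P.
Proof.
move=> a b _ e e0.
have K1 : 0 < n%:R * K + 1 by rewrite ltr_wpDl// mulr_ge0.
exists (e / (n%:R * K + 1)); first by rewrite divr_gt0.
move=> k s t st _; rewrite ltr_pdivlMr// => H; apply: le_lt_trans H.
rewrite mulrC mulr_sumr; apply: ler_sum => i _.
have [_ sti _] := st i.
apply: le_trans (enorm_le_norm _) _.
have ts : 0 <= t i - s i by rewrite subr_ge0.
apply: (@le_trans _ _ (n%:R * (K * (t i - s i)))).
  by rewrite ler_wpM2l//; have := PK (t i) (s i); rewrite (ger0_norm ts).
by rewrite mulrA ler_wpM2r// lerDl.
Qed.

(** Coordinates are indexed by all natural numbers, vacuously from [n] on, so that the closure of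
    null sets under countable unions gives one exceptional set for all of them. *)
Lemma lipschitz_curve_ae_derivable :
  {ae (@lebesgue_measure R), forall t, derivable P t 1}.
Proof.
have H (k : nat) : {ae (@lebesgue_measure R),
    forall t, forall i : 'I_n, i = k :> nat -> derivable (fun t => P t ord0 i) t 1}.
  have [kn|kn] := ltnP k n; last first.
    by apply: aeW => t i ik; move: (ltn_ord i); rewrite ik ltnNge kn.
  have fL x y : `|P x ord0 (Ordinal kn) - P y ord0 (Ordinal kn)| <= K * `|x - y|.
    apply: le_trans (PK x y).
    by have := coord_le_norm (P x - P y) (Ordinal kn); rewrite !mxE.
  have := lipschitz_ae_derivable K0 fL.
  apply: filterS; first exact: (ae_filter_ringOfSetsType lebesgue_measure).
  by move=> t dt i ik; rewrite (_ : i = Ordinal kn)//; exact: val_inj.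
have HH : {ae (@lebesgue_measure R), forall t, forall k : nat,
    forall i : 'I_n, i = k :> nat -> derivable (fun t => P t ord0 i) t 1}.
  exact: ae_foralln H.
move: HH; apply: filterS; first exact: (ae_filter_ringOfSetsType lebesgue_measure).
move=> t Ht; apply/derivable_mxP => i j.
by rewrite (ord1 i); exact: (Ht j).
Qed.

(** Derivability identifies the derivative with the limit from the right, where division by [s > 0]
    preserves the inequality. *)
Lemma dot_derive1_le t w D r : derivable P t 1 -> 0 < r ->
  (forall s, 0 < s < r -> - dot (P (t + s) - P t) w <= s * D) ->
  dot (- derive1 P t) w <= D.
Proof.
move=> dP r0 H.
have lP : (fun s : R => s^-1 *: (P (s + t) - P t)) @ 0^' --> derive1 P t.
  have := dP; rewrite /derivable /derive1.
  rewrite (_ : (fun h => _) = (fun h : R => h^-1 *: (P (h + t) - P t))) //.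
  by apply/funext => s /=; rewrite [s *: 1]mulr1.
have lP' : (fun s : R => s^-1 *: (P (s + t) - P t)) @ 0^'+ --> derive1 P t.
  move=> A /lP; rewrite /= /nbhs /= /dnbhs /at_right /within /=.
  by apply: filterS => y H1 y0; apply: H1; rewrite gt_eqF.
have ld : (fun s : R => - dot (s^-1 *: (P (s + t) - P t)) w) @ 0^'+ --> - dot (derive1 P t) w.
  by apply: cvgN; apply: cvg_dot => //; exact: cvg_cst.
rewrite dotNl -(cvg_lim (@Rhausdorff R) ld).
apply: limr_le; first by apply/cvg_ex; eexists; exact: ld.
near=> s.
have s0 : 0 < s by near: s; exact: nbhs_right_gt.
rewrite dotZl -mulrN ler_pdivrMl// (addrC s); apply: H.
rewrite s0 /=; near: s; exact: nbhs_right_lt.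
Unshelve. all: by end_near. Qed.
End lipschitz_curve.

Theorem theorem1p1 (R : realType) (n : nat) (n_gt0 : (0 < n)%N)
    (V : 'rV[R]_n -> R) (h mu1 mu2 : R)
    (V_lip : locally_lipschitz V)
    (V1 : forall q : 'rV[R]_n, V (- q) = V q)
    (mu1_gt0 : 0 < mu1) (mu2_ge0 : 0 <= mu2)
    (V2 : forall q y : 'rV[R]_n,
      clarke_gradient V q y -> mu1 * V q - mu2 <= dot y q)
    (V3 : exists r : R, forall q : 'rV[R]_n, r <= enorm q -> h <= V q)
    (h_gt : mu2 / mu1 < h) :
  exists q : R -> 'rV[R]_n,
    [/\ is_solution V h q,
        exists2 T : R, 0 < T & periodic q T &
        ~ exists c : 'rV[R]_n, forall t : R, q t = c].
Proof.
have [B [M [C [c [L [d [[M0 C0 c0 L0 d0] [k0 chains]]]]]]]] :=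
  exists_good_chains n_gt0 V_lip V1 mu1_gt0 V2 V3 h_gt.
pose tau (k : nat) : R := (k + k0).+1%:R^-1.
have tau0 k : 0 < tau k by rewrite invr_gt0 ltr0n.
have tauoo : tau @ \oo --> (0 : R).
  by have := @cvg_harmonic R; rewrite -(cvg_shiftn k0).
have orbitE k : exists NU : nat * (int -> 'rV[R]_n),
    good_orbit V h B M C c L d (tau k) NU.1 NU.2.
  have [N [u g]] := chains (k + k0)%N (leq_addl _ _).
  by exists (N, brake_extension N u); exact: good_orbit_of_chain g.
have [NU NUP] := choice orbitE.
have cV := locally_lipschitz_continuous V_lip.
have [Q [P [T [[T0 Q0 QT] [PK QP QE QC]]]]] := limit_orbit cV tau0 M0 C0 c0 d0 NUP tauoo.
have C20 : 0 <= 2 * C by rewrite mulr_ge0// ltW.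
have dQ : derive1 Q = P := taylor_derive1 QP.
exists Q; split.
- split.
  + rewrite dQ; split; first by move=> t; exact: (taylor_derivable QP).
    exact: lipschitz_curve_continuous PK.
  + rewrite dQ; exact: (lipschitz_curve_locally_ac C20 PK).
  + rewrite dQ; have := lipschitz_curve_ae_derivable C20 PK.
    apply: filterS; first exact: (ae_filter_ringOfSetsType lebesgue_measure).
    (* [QC] holds at every time and for all directions, so the exceptional null set comes from the
       derivability of [P] alone and does not depend on [w]. *)
    move=> t dP; split=> //; apply/clarke_gradientP => w e D e0 H.
    have [r r0 rP] := QC t w e D e0 H.
    exact: (dot_derive1_le dP r0 rP).
  + by move=> t; rewrite dQ enorm2E QE.
- by exists T.
- move=> [q Qq].
  (* A constant solution would rest at [Q 0 = 0], and the energy equation would force V 0 = h,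
     against [center_inside]. *)
  have QE0 : Q = cst 0 by apply/funext => t; rewrite Qq -(Qq 0) Q0.
  have P0 : P 0 = 0 by rewrite -dQ QE0 derive1_cst.
  have := QE 0; rewrite P0 dot0l mulr0 add0r Q0 => V0.
  by have := center_inside V1 mu1_gt0 V2 h_gt; rewrite V0 ltxx.
Qed.
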